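(* Let $x^{+}=f(x,u)$ with $\dim(x)=n$, $\dim(u)=m$ be a flat discrete-time system with flat output $y=\varphi(\zeta_{[-q_1]},\dots,\zeta_{[-1]},x,u,\dots,u_{[q_2]})$ and associated multi-index $R=(r^1,\dots,r^m)$, in the sense fixed in the context. Let $A=(a^{1},\ldots,a^{m})$ denote a multi-index with $a^{j}\geq 0$, $j=1,\ldots,m$. The system permits arbitrary trajectories $v(k+\alpha)$, $\alpha\geq 0$, for the forward-shifts $v=\delta^{A}(\varphi)$ of the flat output regardless of its current state $x(k)$ and past values $\zeta(k-\beta)$, $\beta\geq 1$, if and only if the differentials $$\mathrm{d}\zeta_{[-q_{1}+A]},\ldots,\mathrm{d}\zeta_{[-1]},\ \mathrm{d}x,\ \mathrm{d}\delta^{A}(\varphi),\ldots,\mathrm{d}\delta^{R-1}(\varphi)$$ are linearly independent. Here, according to the multi-index convention stated in the context, $\mathrm{d}\zeta_{[-q_1+A]},\ldots,\mathrm{d}\zeta_{[-1]}$ denotes the collection of all $\mathrm{d}\zeta^j_{[\beta]}$ with $1\le j\le m$ and $-q_1+a^j\le\beta\le-1$ (no entry for those $j$ with $-q_1+a^j>-1$); $\mathrm{d}x$ denotes $\mathrm{d}x^1,\ldots,\mathrm{d}x^n$; and $\mathrm{d}\delta^{A}(\varphi),\ldots,\mathrm{d}\delta^{R-1}(\varphi)$ denotes the collection of all $\mathrm{d}\delta^{\alpha}(\varphi^j)$ with $1\le j\le m$ and $a^j\le\alpha\le r^j-1$ (no entry for those $j$ with $a^j>r^j-1$).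
   Context: System. All functions are smooth and all considerations are local, in a suitable neighborhood of an equilibrium $(x_0,u_0)$, $x_0=f(x_0,u_0)$. The system is $x^{i,+}=f^i(x,u)$, $i=1,\dots,n$, with $u=(u^1,\dots,u^m)$ and $\mathrm{rank}(\partial_{(x,u)}f)=n$. By this rank condition one can choose $m$ functions $g(x,u)$ such that $(x,u)\mapsto(x^+,\zeta)=(f(x,u),g(x,u))$ is locally invertible; fix such a $g$ and write the inverse as $(x,u)=\psi(x^+,\zeta)=(\psi_x(x^+,\zeta),\psi_u(x^+,\zeta))$. Thus $\zeta=(\zeta^1,\dots,\zeta^m)$ has $m$ components, and along a trajectory $\zeta(k)=g(x(k),u(k))$. Shifts. On a finite time interval, system trajectories are identified with points of a manifold with coordinates $(\zeta_{[-l_\zeta]},\dots,\zeta_{[-1]},x,u,u_{[1]},\dots,u_{[l_u]})$, where $\zeta_{[-\beta]}$ stands for $\zeta(k-\beta)$ and $u_{[\alpha]}$ for $u(k+\alpha)$; $l_\zeta,l_u$ are chosen sufficiently large for all functions considered. The point corresponding to the equilibrium is $(\zeta_0,\dots,\zeta_0,x_0,u_0,\dots,u_0)$ with $\zeta_0=g(x_0,u_0)$. The forward-shift operator is $$\delta(h(\dots,\zeta_{[-2]},\zeta_{[-1]},x,u,u_{[1]},\dots))=h(\dots,\zeta_{[-1]},g(x,u),f(x,u),u_{[1]},u_{[2]},\dots),$$ and the backward-shift operator is $$\delta^{-1}(h(\dots,\zeta_{[-1]},x,u,u_{[1]},\dots))=h(\dots,\zeta_{[-2]},\psi_x(x,\zeta_{[-1]}),\psi_u(x,\zeta_{[-1]}),u,\dots).$$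 $\delta^{\alpha}$ denotes repeated application. Flatness. The system is flat around $(x_0,u_0)$ if the $n+m$ coordinate functions $x$ and $u$ can be expressed locally by an $m$-tuple of functions $y^j=\varphi^j(\zeta_{[-q_1]},\dots,\zeta_{[-1]},x,u,\dots,u_{[q_2]})$, $j=1,\dots,m$, and their forward-shifts $y_{[\alpha]}=\delta^\alpha(\varphi)$ up to some finite order; $\varphi$ is then called a flat output. The representation is unique and has the form $x=F_x(y,\dots,y_{[R-1]})$, $u=F_u(y,\dots,y_{[R]})$, where the multi-index $R=(r^1,\dots,r^m)$ consists of the numbers of forward-shifts of each component of the flat output needed to express $x$ and $u$. Multi-indices. For an $m$-tuple $w=(w^1,\dots,w^m)$ and a multi-index $A=(a^1,\dots,a^m)$, $w_{[A]}=(w^1_{[a^1]},\dots,w^m_{[a^m]})$; likewise $\delta^A(\varphi)=(\delta^{a^1}(\varphi^1),\dots,\delta^{a^m}(\varphi^m))$. For an integer $c$, $A\pm c=(a^1\pm c,\dots,a^m\pm c)$, so $-q_1+A=(-q_1+a^1,\dots,-q_1+a^m)$. A range of shifts of a component whose lower bound exceeds its upper bound is empty. Meaning of ''permits arbitrary trajectories''. For every possible state $x(k)$ and past values $\zeta(k-\beta)$, $\beta\ge1$, and every desired trajectory $v(k+\alpha)$, $\alpha\ge0$, there exists a trajectory $u(k+\alpha)$, $\alpha\ge0$, of the original control input such that $v=\delta^A(\varphi)$ evaluated along the resulting system trajectory equals the desired trajectory. As everything else, this is understood locally, near the equilibrium, and with trajectories considered on finite time intervals as explained above.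
   Formalization: Two hypotheses are added, as the equivalence fails without them: the listed differentials have constant rank near the equilibrium, and each shift δ^{a^j}(φ^j) with a^j<r^j depends on past values only through the listed ζ_{[-q1+A]},…,ζ_{[-1]}. *)

(* Defs.v *)
From HB Require Import structures.
From mathcomp Require Import all_boot all_order all_algebra.
From mathcomp Require Import all_classical all_reals all_analysis.

Set Implicit Arguments.
Unset Strict Implicit.
Unset Printing Implicit Defensive.

Import Order.TTheory GRing.Theory Num.Theory.
Import numFieldNormedType.Exports.

Local Open Scope classical_set_scope.
Local Open Scope ring_scope.

(* For a finite-dimensional domain [V] and an open set [U], this is the usual
   class C^k on [U]: a differentiable map all of whose directional derivatives
   are C^(k-1) is C^k. *)
Fixpoint Ck_on (R : realType) (V W : normedModType R) (k : nat)
    (U : set V) (h : V -> W) : Prop :=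
  if k is k'.+1 then
    (forall p, U p -> differentiable h p) /\
    (forall v, Ck_on k' U (fun p => 'D_v h p))
  else forall p, U p -> {for p, continuous h}.

Definition smooth_near (R : realType) (V W : normedModType R)
    (h : V -> W) (p : V) : Prop :=
  exists U : set V, open_nbhs p U /\ forall k, Ck_on k U h.

(* A system x^+ = f(x,u) with equilibrium (x0,u0), together with a fixed
   complement zeta = g(x,u) and the local inverse psi of (f,g).  All maps are
   total, but nothing is assumed about them away from the equilibrium. *)
Record dsystem (R : realType) (n m : nat) := DSystem {
  sys_f : 'rV[R]_n * 'rV[R]_m -> 'rV[R]_n ;
  sys_g : 'rV[R]_n * 'rV[R]_m -> 'rV[R]_m ;
  sys_psi : 'rV[R]_n * 'rV[R]_m -> 'rV[R]_n * 'rV[R]_m ;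
  sys_x0 : 'rV[R]_n ;
  sys_u0 : 'rV[R]_m ;
  sys_equilibrium : sys_f (sys_x0, sys_u0) = sys_x0 ;
  sys_f_smooth : smooth_near sys_f (sys_x0, sys_u0) ;
  sys_f_rank : \dim (limg (linfun ('d sys_f (sys_x0, sys_u0)))) = n ;
  sys_g_smooth : smooth_near sys_g (sys_x0, sys_u0) ;
  sys_psi_smooth : smooth_near sys_psi (sys_x0, sys_g (sys_x0, sys_u0)) ;
  sys_psiK : \forall xu \near (sys_x0, sys_u0),
    sys_psi (sys_f xu, sys_g xu) = xu ;
  sys_psiKV : \forall xz \near (sys_x0, sys_g (sys_x0, sys_u0)),
    (sys_f (sys_psi xz), sys_g (sys_psi xz)) = xz
}.

(* The value zeta0 of zeta at the equilibrium. *)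
Definition sys_z0 (R : realType) (n m : nat) (S : dsystem R n m) : 'rV[R]_m :=
  sys_g S (sys_x0 S, sys_u0 S).

(* A trajectory seen from the current time: [past b] is zeta_[-(b+1)] (the
   index is shifted by one) and [input a] is u_[a].  The sequences are infinite
   so that shifts are total; every function considered only depends on finitely
   many entries. *)
Record tpoint (R : realType) (n m : nat) := TPoint {
  past : nat -> 'rV[R]_m ;
  state : 'rV[R]_n ;
  input : nat -> 'rV[R]_m
}.

Definition tpoint_eq (R : realType) (n m : nat) (S : dsystem R n m) :
    tpoint R n m :=
  TPoint (fun=> sys_z0 S) (sys_x0 S) (fun=> sys_u0 S).

Definition near_eq (R : realType) (n m : nat) (S : dsystem R n m) (e : R)
    (p : tpoint R n m) : Prop :=
  [/\ forall b, `|past p b - sys_z0 S| < e,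
      `|state p - sys_x0 S| < e
    & forall k, `|input p k - sys_u0 S| < e].

Definition step (R : realType) (n m : nat) (S : dsystem R n m)
    (p : tpoint R n m) : tpoint R n m :=
  let xu := (state p, input p 0%N) in
  TPoint (fun b => if b is b'.+1 then past p b' else sys_g S xu)
         (sys_f S xu)
         (fun k => input p k.+1).

Definition delta (R : realType) (n m : nat) (S : dsystem R n m) (T : Type)
    (h : tpoint R n m -> T) : tpoint R n m -> T :=
  fun p => h (step S p).
Arguments delta {R n m} S {T} h p.

(* The coordinates (zeta_[-lz], ..., zeta_[-1], x, u, ..., u_[lu]): row [b] of
   the first matrix is zeta_[-(b+1)], row [k] of the last one is u_[k]. *)
Notation window R n m lz lu :=
  ('M[R]_(lz, m) * 'rV[R]_n * 'M[R]_(lu.+1, m))%type.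

Definition window_of (R : realType) (n m lz lu : nat) (p : tpoint R n m) :
    window R n m lz lu :=
  (\matrix_(b < lz) past p b, state p, \matrix_(k < lu.+1) input p k).

(* The padding with equilibrium values is irrelevant for functions that only
   depend on the entries inside the window. *)
Definition of_window (R : realType) (n m : nat) (S : dsystem R n m)
    (lz lu : nat) (w : window R n m lz lu) : tpoint R n m :=
  TPoint (fun b => if insub b is Some i then row i w.1.1 else sys_z0 S)
         w.1.2
         (fun k => if insub k is Some i then row i w.2 else sys_u0 S).

Section FlatOutput.
Variables (R : realType) (n m : nat) (S : dsystem R n m) (q1 q2 : nat).
Variable phi : window R n m q1 q2 -> 'rV[R]_m.

(* delta^k (phi^j) *)
Definition yshift (j : 'I_m) (k : nat) : tpoint R n m -> R :=
  iter k (delta S) (fun p => phi (window_of q1 q2 p) 0 j).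

(* The vector of all y^j_[k] with k < d j, i.e. (y, ..., y_[D-1]). *)
Definition jet (d : 'I_m -> nat) (p : tpoint R n m) :
    'rV[R]_#|{: {j : 'I_m & 'I_(d j)}}| :=
  \row_i (let t : {j : 'I_m & 'I_(d j)} := enum_val i in
          yshift (tag t) (tagged t) p).

(* x = F_x(y, ..., y_[r-1]) and u = F_u(y, ..., y_[r]). *)
Definition flat_repr (r : 'I_m -> nat) : Prop :=
  exists (Fx : 'rV[R]_#|{: {j : 'I_m & 'I_(r j)}}| -> 'rV[R]_n)
         (Fu : 'rV[R]_#|{: {j : 'I_m & 'I_(r j).+1}}| -> 'rV[R]_m),
  [/\ smooth_near Fx (jet r (tpoint_eq S)),
      smooth_near Fu (jet (fun j => (r j).+1) (tpoint_eq S))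
    & exists2 e : R, 0 < e &
      forall p, near_eq S e p ->
        Fx (jet r p) = state p /\
        Fu (jet (fun j => (r j).+1) p) = input p 0%N].

(* phi is a flat output; r j is the number of forward-shifts of its j-th
   component that is needed in order to express x and u. *)
Definition flat_output (r : 'I_m -> nat) : Prop :=
  [/\ smooth_near phi (window_of q1 q2 (tpoint_eq S)),
      flat_repr r
    & forall r', flat_repr r' -> forall j, (r j <= r' j)%N].

(* Locally, and on every finite time interval k, ..., k+L: for every current
   state, all past values of zeta and every reference v (all close to the
   equilibrium), some input trajectory, close to u0, realizes v^j as
   delta^(a j) (phi^j). *)
Definition permits_arbitrary_trajectories (a : 'I_m -> nat) : Prop :=
  forall (L : nat) (e : R), 0 < e ->
  exists2 d : R, 0 < d &
  forall (z : nat -> 'rV[R]_m) (x : 'rV[R]_n) (v : nat -> 'rV[R]_m),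
    (forall b, `|z b - sys_z0 S| < d) ->
    `|x - sys_x0 S| < d ->
    (forall k, `|v k - phi (window_of q1 q2 (tpoint_eq S))| < d) ->
  exists u : nat -> 'rV[R]_m,
    (forall k, `|u k - sys_u0 S| < e) /\
    (forall k (j : 'I_m), (k <= L)%N ->
      yshift j (a j) (iter k (step S) (TPoint z x u)) = v k 0 j).

Variables r a : 'I_m -> nat.

(* The functions zeta^j_[-(b+1)] with b < q1 - a j, that is
   -q1 + a j <= -(b+1) <= -1 (truncated subtraction: none if q1 <= a j), then
   x^i, then delta^(a j + k) (phi^j) with k < r j - a j. *)
Definition listed_index : finType :=
  ({j : 'I_m & 'I_(q1 - a j)} + 'I_n + {j : 'I_m & 'I_(r j - a j)})%type.

Definition listed (i : listed_index) : tpoint R n m -> R :=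
  match i with
  | inl (inl t) => fun p => past p (tagged t) 0 (tag t)
  | inl (inr k) => fun p => state p 0 k
  | inr t => yshift (tag t) (a (tag t) + tagged t)
  end.

(* Their differentials at [w]. *)
Definition listed_diff (lz lu : nat) (w : window R n m lz lu) :
    seq 'Hom(window R n m lz lu, R^o) :=
  [seq linfun ('d (fun w' => listed i (of_window S w') : R^o) w)
     | i : listed_index].

(* Near the equilibrium the listed zeta^j_[-(b+1)] are the only past values on
   which the listed shifts of phi depend: delta^A(phi) is a function of
   zeta_[-q1+A], ..., zeta_[-1], x, u, ....  This holds automatically if all
   a j are equal, or if q1, which need not be minimal for phi, is taken large
   enough. *)
Definition listed_past_suffices : Prop :=
  exists2 e : R, 0 < e &
  forall p p' : tpoint R n m, near_eq S e p -> near_eq S e p' ->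
    (forall (j : 'I_m) b, (b < q1 - a j)%N -> past p b 0 j = past p' b 0 j) ->
    state p = state p' ->
    input p = input p' ->
  forall j, (a j < r j)%N -> yshift j (a j) p = yshift j (a j) p'.

(* The differentials span a space of locally constant dimension, i.e. the
   equilibrium is not a singular point: u |-> x - u^3 is locally onto at 0
   although its differential vanishes there. *)
Definition listed_constant_rank (lz lu : nat) : Prop :=
  let w0 := window_of lz lu (tpoint_eq S) in
  \forall w \near w0, \dim <<listed_diff w>> = \dim <<listed_diff w0>>.

Definition listed_diff_independent (lz lu : nat) : Prop :=
  \forall w \near window_of lz lu (tpoint_eq S), free (listed_diff w).

End FlatOutput.

(* Main.v *)
Require Import Defs.
From HB Require Import structures.
From mathcomp Require Import all_boot all_order all_algebra.
From mathcomp Require Import all_classical all_reals all_analysis.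
From mathcomp Require Import lra ring zify.

(** Linearize at the equilibrium and write y_j(l) for the differential of the
    l-th shift of the j-th component of the flat output. The equilibrium is a
    fixed point of the shift, so y_j(l) is y_j(0) composed with the l-th power
    of one linear map on tangent trajectories.

    All the y_j(l) are independent. By F_u the inputs are u = P y, with P a
    square matrix of polynomials in the shift. A relation c y = 0 with c <> 0
    would give, by Cramer's rule ([poly_relation]), some d <> 0 and s with
    d P = s c, hence d u = 0; but the inputs are free ([flat_independent]).
    Dually, finitely many y_j(l) can be prescribed ([lshift_onto]).

    Sufficiency. Prescribe y_j(l) = 0 for l < q1 + r_j. By F_x and F_u the
    state and the past seen after q1 steps vanish, while the y_j(l) with
    l >= q1 + r_j are still arbitrary. So from zero past and zero state the
    inputs alone reach arbitrary y_j(l), l >= r_j, together with y_j(l) = 0 for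
    l < r_j ([lshift_high_onto]). The shifts of order a_j to r_j - 1 are reached
    because the listed differentials are independent ([free_listed_onto]).
    Together the inputs reach every y_j(l), l >= a_j ([input_onto]): this
    derivative is onto, and the nonlinear equations are solved by a contraction,
    uniformly in the past, the state and the reference ([straighten_onto],
    [permits_of_free]).

    Necessity. If all trajectories are possible, the listed functions take all
    values close to the equilibrium ones ([listed_values]). Select listed
    functions whose differentials form a basis of the span at the equilibrium.
    As the rank is constant, they do so nearby too, and any listed function
    outside the selection is constant on the fibres of the selected ones
    ([fibre_constant]). It could then not be varied alone, so every listed
    function is selected ([free_of_permits]).

    Derivatives are handled in the strict sense: the error h q - h q' - D (q - q')
    is small relative to q - q' for both points close to w. For continuously
    differentiable maps this follows from the mean value inequality, it is
    stable under composition, and it provides at once the contraction constants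
    and the continuity of the derivative at w. *)

Set Implicit Arguments.
Unset Strict Implicit.
Unset Printing Implicit Defensive.

Import Order.TTheory GRing.Theory Num.Theory.
Import numFieldNormedType.Exports.

Local Open Scope classical_set_scope.
Local Open Scope ring_scope.

(* Banach's fixed point theorem needs matrices as a complete normed module. *)
HB.instance Definition _ (R : realType) (m n : nat) :=
  Uniform_isComplete.Build 'M[R]_(m, n) (@mx_complete R m n).

(** * Strict derivatives *)

Section StrictDerivative.
Context {R : realType}.
Implicit Types V W Z : normedModType R.

Definition bounded_linear V W (D : V -> W) : Prop :=
  (forall c u v, D (c *: u + v) = c *: D u + D v) /\
  exists2 C : R, 0 < C & forall v, `|D v| <= C * `|v|.

Definition strict_deriv V W (h : V -> W) (w : V) (D : V -> W) : Prop :=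
  bounded_linear D /\
  forall e : R, 0 < e -> exists2 d : R, 0 < d & forall q q',
    `|q - w| < d -> `|q' - w| < d ->
    `|h q - h q' - D (q - q')| <= e * `|q - q'|.

Lemma nearP_norm V (w : V) (P : V -> Prop) :
  (\forall q \near w, P q) <->
  exists2 d : R, 0 < d & forall q, `|q - w| < d -> P q.
Proof.
split=> [/nbhs_normP[d /= d0 Hd]|[d d0 Hd]].
  by exists d => // q qw; apply: Hd; rewrite /= distrC.
by apply/nbhs_normP; exists d => // q /=; rewrite distrC; exact: Hd.
Qed.

Lemma blin0 V W (D : V -> W) : bounded_linear D -> D 0 = 0.
Proof. by case=> /(_ (-1) 0 0); rewrite scaleN1r oppr0 addr0 scaleN1r addNr. Qed.

Lemma blinD V W (D : V -> W) u v : bounded_linear D -> D (u + v) = D u + D v.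
Proof. by case=> /(_ 1 u v); rewrite !scale1r. Qed.

Lemma blinZ V W (D : V -> W) c u : bounded_linear D -> D (c *: u) = c *: D u.
Proof. by move=> bD; rewrite -[c *: u]addr0 bD.1 (blin0 bD) addr0. Qed.

Lemma blinB V W (D : V -> W) u v : bounded_linear D -> D (u - v) = D u - D v.
Proof. by move=> bD; rewrite -scaleN1r addrC bD.1 scaleN1r addrC. Qed.

Lemma blin_sum V W (D : V -> W) (I : Type) (s : seq I) (F : I -> V) :
  bounded_linear D -> D (\sum_(i <- s) F i) = \sum_(i <- s) D (F i).
Proof.
move=> bD; elim: s => [|i s IHs]; first by rewrite !big_nil blin0.
by rewrite !big_cons blinD // IHs.
Qed.

Lemma blin_comp V W Z (D : V -> W) (E : W -> Z) :
  bounded_linear D -> bounded_linear E -> bounded_linear (fun v => E (D v)).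
Proof.
move=> [lD [C C0 bD]] [lE [C' C'0 bE]]; split=> [c u v|]; first by rewrite lD lE.
exists (C' * C) => [|v]; first exact: mulr_gt0.
by rewrite -mulrA (le_trans (bE _)) // ler_pM2l.
Qed.

Lemma blin_linear V W (D : V -> W) : bounded_linear D ->
  exists2 L : {linear V -> W}, D = L & continuous L.
Proof.
move=> [lD [C C0 bD]].
have lD' : linear D by move=> c u v; exact: lD.
pose L : {linear V -> W} := HB.pack D (GRing.isLinear.Build R V W _ D lD').
exists L => //; apply: bounded_linear_continuous.
apply/ex_bound; exists C; apply/nbhs_norm0P; exists 1 => //= x /= x1.
by apply: (le_trans (bD x)); rewrite ler_piMr ?ltW.
Qed.

Lemma linear_blin V W (D : {linear V -> W}) : continuous D -> bounded_linear D.
Proof.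
move=> /linear_bounded_continuous/linear_boundedP/pinfty_ex_gt0[C C0 bC].
by split=> [c u v|]; [exact: linearP | exists C].
Qed.

Lemma sd_lip V W (h : V -> W) w D : strict_deriv h w D ->
  exists2 C : R, 0 < C & exists2 d : R, 0 < d & forall q q',
    `|q - w| < d -> `|q' - w| < d -> `|h q - h q'| <= C * `|q - q'|.
Proof.
move=> [[lD [C C0 bD]] /(_ 1 ltr01)[d d0 Hd]].
exists (C + 1); first by rewrite addr_gt0.
exists d => // q q' hq hq'; rewrite -[h q - h q'](subrK (D (q - q'))).
by rewrite (le_trans (ler_normD _ _)) // addrC mulrDl lerD // Hd.
Qed.

Lemma sd_comp V W Z (h : V -> W) (k : W -> Z) w D E :
  strict_deriv h w D -> strict_deriv k (h w) E ->
  strict_deriv (fun q => k (h q)) w (fun v => E (D v)).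
Proof.
move=> sh [bE sk]; have bD := sh.1; split; first exact: blin_comp.
move=> e e0; have [C C0 [d1 d10 lip]] := sd_lip sh.
have [CE CE0 bCE] := bE.2.
have [d2 d20 H2] := sk (e / 2 / C) ltac:(by rewrite !divr_gt0).
have [d3 d30 H3] := sh.2 (e / 2 / CE) ltac:(by rewrite !divr_gt0).
exists (Num.min (Num.min d1 d3) (d2 / C)).
  by rewrite !lt_min d10 d30 divr_gt0.
move=> q q'; rewrite !lt_min => /andP[/andP[q1 q3] q2] /andP[/andP[q'1 q'3] q'2].
have w1 : `|w - w| < d1 by rewrite subrr normr0.
have hq2 : `|h q - h w| < d2.
  by apply: (le_lt_trans (lip _ _ q1 w1)); rewrite mulrC -ltr_pdivlMr.
have hq'2 : `|h q' - h w| < d2.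
  by apply: (le_lt_trans (lip _ _ q'1 w1)); rewrite mulrC -ltr_pdivlMr.
have -> : k (h q) - k (h q') - E (D (q - q')) =
   (k (h q) - k (h q') - E (h q - h q')) + E (h q - h q' - D (q - q')).
  by rewrite (blinB (h q - h q') (D (q - q')) bE) addrA subrK.
rewrite (le_trans (ler_normD _ _)) //.
have -> : e * `|q - q'| = e / 2 * `|q - q'| + e / 2 * `|q - q'|.
  by rewrite -mulrDl -splitr.
apply: lerD.
  apply: (le_trans (H2 _ _ hq2 hq'2)).
  have := lip _ _ q1 q'1; rewrite -(ler_pM2l (_ : 0 < e / 2 / C)) ?divr_gt0 //.
  by rewrite mulrA divfK ?gt_eqF.
apply: (le_trans (bCE _)); rewrite -ler_pdivlMl //.
rewrite mulrA [CE^-1 * _]mulrC. exact: H3.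
Qed.

Lemma sd_affine V W (h : V -> W) w D : bounded_linear D ->
  (forall q q', h q - h q' = D (q - q')) -> strict_deriv h w D.
Proof.
move=> bD hD; split=> // e e0; exists 1 => // q q' _ _.
by rewrite hD subrr normr0 mulr_ge0 // ltW.
Qed.

Lemma sd_lin V W (D : V -> W) w : bounded_linear D -> strict_deriv D w D.
Proof. by move=> bD; apply: sd_affine => // q q'; rewrite blinB. Qed.

Lemma sd_cst V W (c : W) (w : V) : strict_deriv (fun=> c) w (fun=> 0).
Proof.
apply: sd_affine => [|q q']; last by rewrite subrr.
split=> [c' u v|]; first by rewrite scaler0 addr0.
by exists 1 => // v; rewrite normr0 mul1r.
Qed.

Lemma sd_near_eq V W (h h' : V -> W) w D :
  (\forall q \near w, h q = h' q) -> strict_deriv h w D -> strict_deriv h' w D.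
Proof.
move=> /nearP_norm[d1 d10 H1] [bD sD]; split=> // e /sD[d d0 Hd].
exists (Num.min d1 d); first by rewrite lt_min d10.
move=> q q'; rewrite !lt_min => /andP[q1 q2] /andP[q'1 q'2].
by rewrite -!H1 // Hd.
Qed.

(** Only points on the line through [w] in the direction [v] matter: with
    [c = 0] this kills the derivative along a direction in which [h] does not
    vary, with small [c] it compares two derivatives. *)
Lemma sd_line_bound V W (h : V -> W) w D v c : strict_deriv h w D ->
  (\forall q \near w, (exists t, q = w + t *: v) ->
     `|h q - h w| <= c * `|q - w|) ->
  `|D v| <= c * `|v|.
Proof.
move=> [bD sD] /nearP_norm[d1 d10 H1].
apply/ler_addgt0Pl => e e0.
have [->|v0] := eqVneq v 0; first by rewrite blin0 // !normr0 mulr0 addr0 ltW.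
have nv0 : 0 < `|v| by rewrite normr_gt0.
have [d d0 Hd] := sD (e / `|v|) ltac:(by rewrite divr_gt0).
pose t : R := Num.min d1 d / 2 / `|v|.
have t0 : 0 < t by rewrite !divr_gt0 // lt_min d10.
have tv : `|w + t *: v - w| < Num.min d1 d.
  rewrite addrC addKr normrZ gtr0_norm // divfK ?gt_eqF //.
  by rewrite ltr_pdivrMr // ltr_pMr ?ltr1n // lt_min d10.
move: tv; rewrite lt_min => /andP[tv1 tv2].
move: t t0 tv1 tv2 => t t0 tv1 tv2.
have := Hd (w + t *: v) w tv2; rewrite subrr normr0 => /(_ d0).
have := H1 _ tv1 (ex_intro _ t erefl).
rewrite [w + _]addrC addrK (blinZ _ _ bD) normrZ gtr0_norm // => h1 h2.
rewrite -(ler_pM2l t0).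
have <- : `|t *: D v| = t * `|D v| by rewrite normrZ gtr0_norm.
rewrite -[t *: D v](subKr (h (t *: v + w) - h w)).
rewrite (le_trans (ler_normB _ _)) // mulrDr addrC lerD //; last by rewrite mulrCA.
by rewrite (le_trans h2) // [leLHS]mulrCA divfK ?gt_eqF.
Qed.

Lemma sd_sub V W (h k : V -> W) w D E : strict_deriv h w D ->
  strict_deriv k w E -> strict_deriv (fun q => h q - k q) w (fun v => D v - E v).
Proof.
move=> [[lD [C C0 bD]] sD] [[lE [C' C'0 bE]] sE]; split.
  split=> [c u v|].
    by rewrite lD lE opprD scalerBr addrACA.
  exists (C + C') => [|v]; first exact: addr_gt0.
  by rewrite mulrDl (le_trans (ler_normB _ _)) // lerD.
move=> e e0.
have [d1 d10 H1] := sD (e / 2) ltac:(by rewrite divr_gt0).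
have [d2 d20 H2] := sE (e / 2) ltac:(by rewrite divr_gt0).
exists (Num.min d1 d2) => [|q q']; first by rewrite lt_min d10.
rewrite !lt_min => /andP[q1 q2] /andP[q'1 q'2].
have -> : h q - k q - (h q' - k q') - (D (q - q') - E (q - q')) =
  (h q - h q' - D (q - q')) - (k q - k q' - E (q - q')).
  by rewrite !opprB (AC (2*2*2) ((1*4*6)*(5*(3*2)))).
rewrite (le_trans (ler_normB _ _)) // [e]splitr mulrDl lerD //.
  exact: H1.
exact: H2.
Qed.

End StrictDerivative.

(** * Strict derivatives in products and matrices *)

Section Norms.
Context {R : realType}.
Implicit Types V W Z : normedModType R.

Lemma mx_entry_le m n (M : 'M[R]_(m, n)) i j : `|M i j| <= `|M|.
Proof.
rewrite [leRHS]mx_normrE; exact: (le_bigmax _ (fun ij => `|M ij.1 ij.2|) (i, j)).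
Qed.

Lemma mx_norm_leP m n (M : 'M[R]_(m, n)) c : 0 <= c ->
  (forall i j, `|M i j| <= c) -> `|M| <= c.
Proof.
move=> c0 H; rewrite [leLHS]mx_normrE.
by apply: bigmax_le => // -[i j] _; exact: H.
Qed.

Lemma mx_norm_ltP m n (M : 'M[R]_(m, n)) c : 0 < c ->
  (forall i j, `|M i j| < c) -> `|M| < c.
Proof.
move=> c0 H; rewrite [ltLHS]mx_normrE.
by apply: bigmax_lt => // -[i j] _; exact: H.
Qed.

Lemma pair_normE V W (v : V * W) : `|v| = Num.max `|v.1| `|v.2|.
Proof. by []. Qed.

Lemma fst_norm_le V W (v : V * W) : `|v.1| <= `|v|.
Proof. by rewrite pair_normE le_max lexx. Qed.

Lemma snd_norm_le V W (v : V * W) : `|v.2| <= `|v|.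
Proof. by rewrite pair_normE le_max lexx orbT. Qed.

Lemma blin_fst V W : bounded_linear (@fst V W).
Proof. by split=> //; exists 1 => // v; rewrite mul1r fst_norm_le. Qed.

Lemma blin_snd V W : bounded_linear (@snd V W).
Proof. by split=> //; exists 1 => // v; rewrite mul1r snd_norm_le. Qed.

Lemma blin_pair V W Z (D : V -> W) (E : V -> Z) :
  bounded_linear D -> bounded_linear E -> bounded_linear (fun v => (D v, E v)).
Proof.
move=> [lD [C C0 bD]] [lE [C' C'0 bE]]; split=> [c u v|]; first by rewrite lD lE.
exists (Num.max C C') => [|v]; first by rewrite lt_max C0.
rewrite pair_normE ge_max /=; apply/andP; split.
  by rewrite (le_trans (bD _)) // ler_wpM2r // le_max lexx.
by rewrite (le_trans (bE _)) // ler_wpM2r // le_max lexx orbT.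
Qed.

Lemma sd_pair V W Z (h : V -> W) (k : V -> Z) w D E :
  strict_deriv h w D -> strict_deriv k w E ->
  strict_deriv (fun q => (h q, k q)) w (fun v => (D v, E v)).
Proof.
move=> [bD sD] [bE sE]; split; first exact: blin_pair.
move=> e e0; have [d d0 Hd] := sD _ e0; have [d' d'0 Hd'] := sE _ e0.
exists (Num.min d d') => [|q q']; first by rewrite lt_min d0.
rewrite !lt_min => /andP[q1 q2] /andP[q'1 q'2].
by rewrite pair_normE ge_max /= Hd // Hd'.
Qed.

Lemma blin_entry m n i j : bounded_linear (fun M : 'M[R]_(m, n) => M i j : R^o).
Proof.
split=> [c u v|]; first by rewrite !mxE.
by exists 1 => // v; rewrite mul1r mx_entry_le.
Qed.

Lemma sd_entry V m n (h : V -> 'M[R]_(m, n)) w D i j : strict_deriv h w D ->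
  strict_deriv (fun q => h q i j : R^o) w (fun v => D v i j).
Proof. by move=> sh; exact: sd_comp sh (sd_lin _ (blin_entry i j)). Qed.

Lemma blin_row m n (i : 'I_m) : bounded_linear (fun M : 'M[R]_(m, n) => row i M).
Proof.
split=> [c u v|]; first by rewrite linearP.
exists 1 => // v; rewrite mul1r; apply: mx_norm_leP => // i' j.
by rewrite mxE mx_entry_le.
Qed.

Lemma blin_matrix V m n (D : V -> 'M[R]_(m, n)) :
  (forall i j, bounded_linear (fun v => D v i j : R^o)) -> bounded_linear D.
Proof.
move=> H; split=> [c u v|].
  by apply/matrixP => i j; rewrite (H i j).1 !mxE.
have /choice[C HC] (ij : 'I_m * 'I_n) :
    exists C, 0 < C /\ forall v, `|D v ij.1 ij.2| <= C * `|v|.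
  by have [C] := (H ij.1 ij.2).2; exists C.
exists (1 + \sum_ij C ij) => [|v].
  by rewrite ltr_pwDl // sumr_ge0 // => ij _; rewrite ltW // (HC ij).1.
have C0 : 0 <= \sum_ij C ij by rewrite sumr_ge0 // => ij _; rewrite ltW // (HC ij).1.
apply: mx_norm_leP => [|i j]; first by rewrite mulr_ge0 // addr_ge0.
apply: (le_trans ((HC (i, j)).2 v)); rewrite ler_wpM2r //.
rewrite (bigD1 (i, j)) //= addrCA lerDl addr_ge0 // sumr_ge0 // => ij _.
by rewrite ltW // (HC ij).1.
Qed.

Lemma sd_matrix V m n (h : V -> 'M[R]_(m, n)) w (D : V -> 'M[R]_(m, n)) :
  (forall i j, strict_deriv (fun q => h q i j : R^o) w (fun v => D v i j)) ->
  strict_deriv h w D.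
Proof.
move=> H; split; first by apply: blin_matrix => i j; case: (H i j).
move=> e e0.
have : \forall d \near 0^'+, forall ij : 'I_m * 'I_n, forall q q',
    `|q - w| < d -> `|q' - w| < d ->
    `|h q ij.1 ij.2 - h q' ij.1 ij.2 - D (q - q') ij.1 ij.2| <= e * `|q - q'|.
  apply: filter_forall => -[i j]; have [d0 d00 Hd0] := (H i j).2 _ e0.
  near=> d => q q' qd q'd.
  by apply: Hd0; [apply: lt_trans qd _ | apply: lt_trans q'd _];
    near: d; exact: nbhs_right_lt.
move=> Hnear.
have [d [d0 Hd]] : exists d : R, 0 < d /\ forall ij : 'I_m * 'I_n, forall q q',
    `|q - w| < d -> `|q' - w| < d ->
    `|h q ij.1 ij.2 - h q' ij.1 ij.2 - D (q - q') ij.1 ij.2| <= e * `|q - q'|.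
  near (0:R)^'+ => d; exists d; split; first by [].
  by near: d.
exists d => // q q' qd q'd; apply: mx_norm_leP => [|i j].
  by rewrite mulr_ge0 // ltW.
by rewrite !mxE; exact: (Hd (i, j)).
Unshelve. all: by end_near. Qed.

Lemma sd_row V m n (h : V -> 'I_m -> 'rV[R]_n) w (D : V -> 'I_m -> 'rV[R]_n) :
  (forall i, strict_deriv (h^~ i) w (D^~ i)) ->
  strict_deriv (fun q => \matrix_(i < m) h q i) w (fun v => \matrix_(i < m) D v i).
Proof.
move=> H; apply: sd_matrix => i j.
have -> : (fun q => (\matrix_(i < m) h q i) i j : R^o) = fun q => h q i 0 j.
  by apply/funext => q; rewrite mxE.
have -> : (fun v => (\matrix_(i < m) D v i) i j) = fun v => D v i 0 j.
  by apply/funext => v; rewrite mxE.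
exact: (sd_comp (H i) (sd_lin _ (blin_entry 0 j))).
Qed.

Lemma frechet_diff V W (h : V -> W) w D : bounded_linear D ->
  (forall e : R, 0 < e -> exists2 d : R, 0 < d & forall q, `|q - w| < d ->
     `|h q - h w - D (q - w)| <= e * `|q - w|) ->
  differentiable h w /\ 'd h w = D :> (V -> W).
Proof.
move=> bD sD; have [L DL Lc] := blin_linear bD.
have hL : h \o shift w = cst (h w) + L +o_ 0 id.
  apply/eqaddoP => e e0.
  have [d d0 Hd] := sD _ e0.
  apply/nbhs_norm0P; exists d => //= x xd.
  have := Hd (x + w); rewrite addrK => /(_ xd).
  by rewrite DL /= opprD addrA.
have dL : 'd h w = L :> (V -> W) by exact: diff_unique.
split; last by rewrite dL DL.
by apply/diff_locallyP; split; rewrite dL.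
Qed.

Lemma sd_diff V W (h : V -> W) w D : strict_deriv h w D ->
  differentiable h w /\ 'd h w = D :> (V -> W).
Proof.
move=> [bD sD]; apply: frechet_diff => // e /sD[d d0 Hd].
by exists d => // q qd; apply: Hd; rewrite // subrr normr0.
Qed.

Lemma sd_unique V W (h : V -> W) w D E :
  strict_deriv h w D -> strict_deriv h w E -> D = E.
Proof. by move=> /sd_diff[_ <-] /sd_diff[_ ->]. Qed.

End Norms.

(** * Finite dimension and the mean value inequality *)

Section FiniteDim.
Context {R : realType}.
Implicit Types V W : normedModType R.

(** Finite dimension in the form in which it is used: the coordinates are
    bounded by the norm, so that a map linear in [v] is controlled by its values
    on finitely many vectors. *)
Definition bounded_basis V : Prop :=
  exists (I : finType) (b : I -> V) (c : I -> V -> R) (C : R),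
    [/\ 0 < C, forall v, v = \sum_i c i v *: b i
      & forall i v, `|c i v| <= C * `|v|].

Lemma bounded_basis_mx m n : bounded_basis 'M[R]_(m, n).
Proof.
exists ('I_m * 'I_n)%type, (fun ij => delta_mx ij.1 ij.2),
  (fun ij (M : 'M[R]_(m, n)) => M ij.1 ij.2), 1; split=> // [M|ij M].
  by rewrite [LHS]matrix_sum_delta pair_bigA.
by rewrite mul1r mx_entry_le.
Qed.

Lemma bounded_basis_pair V W :
  bounded_basis V -> bounded_basis W -> bounded_basis (V * W)%type.
Proof.
move=> [I [b [c [C [C0 hv bc]]]]] [I' [b' [c' [C' [C'0 hv' bc']]]]].
exists (I + I')%type, (fun i => match i with inl i => (b i, 0) | inr i => (0, b' i) end),
  (fun i v => match i with inl i => c i v.1 | inr i => c' i v.2 end), (Num.max C C').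
split=> [|v|[i|i] v]; first by rewrite lt_max C0.
- rewrite big_sumType /=; apply: injective_projections => /=.
    rewrite !raddf_sum /= [in LHS](hv v.1) [X in _ + X]big1 ?addr0 // => i _.
    by rewrite scaler0.
  rewrite !raddf_sum /= [in LHS](hv' v.2) [X in X + _]big1 ?add0r // => i _.
  by rewrite scaler0.
- apply: (le_trans (bc _ _)); apply: ler_pM => //; first exact: ltW.
    by rewrite le_max lexx.
  exact: fst_norm_le.
- apply: (le_trans (bc' _ _)); apply: ler_pM => //; first exact: ltW.
    by rewrite le_max lexx orbT.
  exact: snd_norm_le.
Qed.

Lemma linear_bounded_basis V W (D : V -> W) : bounded_basis V ->
  (forall c u v, D (c *: u + v) = c *: D u + D v) -> bounded_linear D.
Proof.
move=> [I [b [c [C [C0 hv bc]]]]] lD; split=> //.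
have lD' : linear D by move=> c' u v; exact: lD.
pose L : {linear V -> W} := HB.pack D (GRing.isLinear.Build R V W _ D lD').
exists (1 + C * \sum_i `|D (b i)|) => [|v].
  by rewrite ltr_pwDl // mulr_ge0 // ?sumr_ge0 // ltW.
rewrite [in leLHS](hv v) -[D]/(L : V -> W) linear_sum (le_trans (ler_norm_sum _ _ _)) //.
apply: (@le_trans _ _ (C * (\sum_i `|D (b i)|) * `|v|)).
  rewrite mulrAC mulr_sumr ler_sum // => i _.
  by rewrite linearZ normrZ ler_wpM2r.
by rewrite ler_wpM2r // lerDr.
Qed.

Lemma diff_frechet V W (h : V -> W) w : differentiable h w ->
  forall e : R, 0 < e -> exists2 d : R, 0 < d & forall q, `|q - w| < d ->
    `|h q - h w - 'd h w (q - w)| <= e * `|q - w|.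
Proof.
move=> /diff_locally/eqaddoP H e e0.
have /nbhs_norm0P[d /= d0 Hd] := H _ e0; exists d => // q qw.
have : `|h (q - w + w) - (h w + 'd h w (q - w))| <= e * `|q - w| by exact: Hd.
by rewrite subrK opprD addrA.
Qed.

(** The derivative is given by its defining estimate, the form in which it is
    verified along a segment below. *)
Lemma mean_value_real (F a : R -> R) (c : R) :
  (forall t : R, 0 <= t <= 1 -> `|a t| <= c /\
     forall e : R, 0 < e -> exists2 d : R, 0 < d & forall s : R, `|s - t| < d ->
       `|F s - F t - (s - t) * a t| <= e * `|s - t|) ->
  `|F 1 - F 0| <= c.
Proof.
move=> H.
have dF (t : R) : 0 <= t <= 1 -> differentiable (F : R^o -> R^o) t /\
    'd (F : R^o -> R^o) t = (fun s : R^o => s * a t) :> (R^o -> R^o).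
  move=> /H[_ Ht]; apply: frechet_diff => //; split=> [x u v|].
    by rewrite mulrDl -mulrA.
  exists (1 + `|a t|) => [|s]; first by rewrite ltr_pwDl.
  by rewrite normrM mulrC ler_wpM2r // lerDr.
have [x x01 ->] : exists2 x : R, x \in `[0, 1]%R & F 1 - F 0 = a x * (1 - 0).
  apply: MVT_segment => [||]; first exact: ler01.
    move=> x; rewrite in_itv /= => /andP[x0 x1].
    have [|dx dxE] := dF x; first by rewrite !ltW.
    apply: DeriveDef; first exact/derivable1_diffP.
    by rewrite deriveE // dxE mul1r.
  apply: continuous_in_subspaceT => x; rewrite inE /= in_itv /= => x01.
  exact: (@differentiable_continuous _ R^o R^o) (dF x x01).1.
by rewrite subr0 mulr1; case: (H x x01).
Qed.

(** Entrywise along the segment; this is sharp because the norm of a matrix is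
    the largest entry. *)
Lemma mx_mean_value V m n (h D : V -> 'M[R]_(m, n)) q q' (c : R) :
  bounded_linear D ->
  (forall t : R, 0 <= t <= 1 -> differentiable h (q' + t *: (q - q')) /\
     `|'d h (q' + t *: (q - q')) (q - q') - D (q - q')| <= c) ->
  `|h q - h q' - D (q - q')| <= c.
Proof.
move=> bD H; have c0 : 0 <= c.
  by apply: (le_trans _ (H 0 _).2); rewrite ?lexx ?ler01.
apply: mx_norm_leP => // i j; set v := q - q' in H *.
pose F (t : R) : R := (h (q' + t *: v) - t *: D v) i j.
have -> : (h q - h q' - D v) i j = F 1 - F 0.
  rewrite /F !scale1r !scale0r subr0 addr0 [q' + _]addrC subrK !mxE.
  by rewrite addrAC.
pose a (t : R) : R := ('d h (q' + t *: v) v - D v) i j.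
apply: (mean_value_real (a := a)) => t /[dup] t01 /H[dh le_c].
split=> [|e e0]; first exact: le_trans (mx_entry_le _ _ _) le_c.
have v1 : 0 < `|v| + 1 by rewrite ltr_wpDl.
have [d d0 Hd] := diff_frechet dh (divr_gt0 e0 v1).
exists (d / (`|v| + 1)) => [|s st]; first exact: divr_gt0.
have shift : q' + s *: v - (q' + t *: v) = (s - t) *: v.
  by rewrite opprD addrACA subrr add0r scalerBl.
have std : `|(s - t) *: v| < d.
  rewrite normrZ; apply: (@le_lt_trans _ _ (`|s - t| * (`|v| + 1))).
    by rewrite ler_wpM2l // lerDl.
  by rewrite -ltr_pdivlMr.
have := Hd (q' + s *: v); rewrite shift linearZ => /(_ std).
set y := _ - _ - _ => le_e.
have -> : F s - F t - (s - t) * a t = y i j.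
  by rewrite /F /a /y !mxE; ring.
apply: (le_trans (mx_entry_le _ _ _)); apply: (le_trans le_e).
rewrite normrZ mulrCA [leRHS]mulrC ler_wpM2l //.
by rewrite mulrAC ler_pdivrMr // ler_pM2l // lerDl.
Qed.

End FiniteDim.

(** * Maps with surjective derivative *)

Section LocalTheory.
Context {R : realType}.
Implicit Types V W : normedModType R.

(** Continuity of the derivative in each of the finitely many basis directions
    makes it continuous in operator norm; conclude by the mean value inequality
    for [h] minus its derivative at [p]. *)
Lemma C1_strict V m n (h : V -> 'M[R]_(m, n)) (U : set V) p :
  bounded_basis V -> open_nbhs p U -> (forall q, U q -> differentiable h q) ->
  (forall v, {for p, continuous (fun q => 'D_v h q)}) ->
  strict_deriv h p ('d h p).
Proof.
move=> [I [b [c [C [C0 hv bc]]]]] [oU Up] dh cD.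
have bD : bounded_linear ('d h p) by apply/linear_blin/diff_continuous/dh.
split=> // e e0.
pose e' := e / (#|I|%:R * C + 1).
have e'0 : 0 < e' by rewrite divr_gt0 // ltr_wpDl // mulr_ge0 // ltW.
have : \forall q \near p, U q /\ forall i, `|'D_(b i) h q - 'D_(b i) h p| < e'.
  apply: filterI; first exact: open_nbhs_nbhs.
  apply: filter_forall => i.
  have /cvgrPdist_lt/(_ _ e'0) := cD (b i).
  by apply: filterS => q; rewrite distrC.
move=> /nearP_norm[d d0 Hd]; exists d => // q q' qd q'd.
apply: mx_mean_value => // t /andP[t0 t1].
have /Hd[Ut Dt] : `|q' + t *: (q - q') - p| < d.
  have -> : q' + t *: (q - q') - p = (1 - t) *: (q' - p) + t *: (q - p).
    have -> : q - q' = (q - p) - (q' - p) by rewrite opprB addrA subrK.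
    rewrite addrAC; move: (q' - p) (q - p) => x y.
    by rewrite scalerBl scale1r scalerBr -addrA [- _ + _]addrC.
  rewrite (le_lt_trans (ler_normD _ _)) // !normrZ !ger0_norm ?subr_ge0 //.
  have [->|tn0] := eqVneq t 0; first by rewrite subr0 mul1r mul0r addr0.
  have tp : 0 < t by rewrite lt_def tn0.
  have -> : d = (1 - t) * d + t * d by rewrite -mulrDl subrK mul1r.
  by rewrite ler_ltD // ?ltr_pM2l // ler_wpM2l ?subr_ge0 // ltW.
split; first exact: dh.
set v := q - q'; set x := q' + t *: v in Ut Dt *.
have -> : 'd h x v - 'd h p v = \sum_i c i v *: ('d h x (b i) - 'd h p (b i)).
  under eq_bigr do rewrite scalerBr; rewrite sumrB.
  by congr (_ - _); rewrite {1}(hv v) linear_sum; apply: eq_bigr => i _;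
    rewrite linearZ.
rewrite (le_trans (ler_norm_sum _ _ _)) //.
apply: (@le_trans _ _ (\sum_(i : I) C * `|v| * e')).
  apply: ler_sum => i _; rewrite normrZ ler_pM //.
  by rewrite -!deriveE ?ltW //; [exact: dh | exact: dh].
rewrite sumr_const -[_ *+ _]mulr_natl mulrA [_ * e']mulrC !mulrA ler_wpM2r //.
rewrite /e' -mulrA mulrAC ler_pdivrMr; last by rewrite ltr_wpDl // mulr_ge0 // ltW.
by rewrite ler_pM2l // lerDl.
Qed.

Lemma smooth_near_strict V m n (h : V -> 'M[R]_(m, n)) p :
  bounded_basis V -> smooth_near h p ->
  \forall q \near p, exists D, strict_deriv h q D.
Proof.
move=> bV [U [oU sU]]; have [dU cU] := sU 1%N.
have := open_nbhs_nbhs oU; apply: filterS => q Uq.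
exists ('d h q); apply: (C1_strict bV (U := U)) => // [|v]; last exact: cU.
by case: oU.
Qed.

(** The strict estimate at [w] bounds the slopes of [h - D] at all nearby
    points. *)
Lemma sd_deriv_near V W (h : V -> W) w D e : strict_deriv h w D -> 0 < e ->
  \forall q \near w, forall D', strict_deriv h q D' ->
     forall v, `|D' v - D v| <= e * `|v|.
Proof.
move=> [bD sD] e0; have [d d0 Hd] := sD _ e0.
apply/nearP_norm; exists d => // q qd D' sD' v.
have sk := sd_sub sD' (sd_lin q bD).
apply: (sd_line_bound sk); apply/nearP_norm.
exists (d - `|q - w|); first by rewrite subr_gt0.
move=> x xq _.
have xd : `|x - w| < d.
  rewrite -(subrK q x) -addrA (le_lt_trans (ler_normD _ _)) //.
  by rewrite -ltrBrDr.
have := Hd x q xd qd; rewrite (blinB _ _ bD).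
by rewrite !opprB (AC (2*2) ((1*4)*(3*2))).
Qed.

(** Near [w0] this map is a small perturbation of the identity, and composing
    [D] with it gives [H]: in the new coordinates [H] is linear. Unlike with
    complementary coordinates, only a right inverse [B] of [D] is needed. *)
Definition straighten V N (H : V -> 'rV[R]_N) (D : V -> 'rV[R]_N)
  (B : 'rV[R]_N -> V) (w : V) : V := w + B (H w - D w).

Section Straighten.
Variables (V : normedModType R) (N : nat) (H : V -> 'rV[R]_N) (w0 : V).
Variables (D : V -> 'rV[R]_N) (B : 'rV[R]_N -> V).
Hypotheses (sH : strict_deriv H w0 D) (bB : bounded_linear B).
Hypothesis BK : cancel B D.

Let Phi := straighten H D B.

Lemma straightenE w : D (Phi w) = H w.
Proof. by rewrite (blinD _ _ sH.1) BK addrC subrK. Qed.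

Let defect : exists2 C : R, 0 < C & (forall s, `|B s| <= C * `|s|) /\
  exists2 d : R, 0 < d & forall q q', `|q - w0| < d -> `|q' - w0| < d ->
   `|(H q - D q) - (H q' - D q')| <= (2 * C)^-1 * `|q - q'|.
Proof.
have [C C0 bC] := bB.2; exists C => //; split=> //.
have [d d0 Hd] := sH.2 (2 * C)^-1 ltac:(by rewrite invr_gt0 mulr_gt0).
exists d => // q q' qd q'd.
have := Hd q q' qd q'd; rewrite (blinB _ _ sH.1) => H1.
by apply: le_trans H1; rewrite !opprB (AC (2*2) ((1*4)*(3*2))).
Qed.

Lemma straighten_lip : exists2 d : R, 0 < d & forall w w',
  `|w - w0| < d -> `|w' - w0| < d -> `|w - w'| <= 2 * `|Phi w - Phi w'|.
Proof.
have [C C0 [bC [d d0 Hd]]] := defect; exists d => // w w' wd w'd.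
have H1 : `|B ((H w - D w) - (H w' - D w'))| <= 2^-1 * `|w - w'|.
  apply: (le_trans (bC _)); rewrite -ler_pdivlMl //.
  by apply: (le_trans (Hd _ _ wd w'd)); rewrite invfM mulrA [C^-1 * _]mulrC.
have E : w - w' = Phi w - Phi w' - B ((H w - D w) - (H w' - D w')).
  rewrite (blinB (H w - D w) (H w' - D w') bB) /Phi /straighten.
  by move: (B _) (B _) => x y; rewrite opprD addrACA addrK.
move: H1; rewrite E; move: (Phi w - Phi w') (B _) => x y H1.
have := ler_normB x y; lra.
Qed.

(** Writing the solution as [om - B s], the equation becomes the fixed point
    equation [s = (H - D) (om - B s)] in the target space of [H], which is
    complete. *)
Lemma straighten_onto e : 0 < e -> exists2 d : R, 0 < d & forall om,
  `|om - Phi w0| < d -> exists2 w, `|w - w0| < e & Phi w = om.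
Proof.
move=> e0; have [C C0 [bC [d1 d10 Hd]]] := defect.
(* [s] ranges over the ball of radius [mu / (2 * C)], where [B] moves the point
   by at most [mu / 2]; with [om] at distance [mu / 4] the point stays within
   [mu] of [w0], and the map has Lipschitz constant 1/2. *)
pose mu := Num.min d1 e; have mu0 : 0 < mu by rewrite lt_min d10.
exists (mu / 4) => [|om omd]; first by rewrite divr_gt0.
pose K q := H q - D q; pose rho := mu / (2 * C).
have rho0 : 0 < rho by rewrite divr_gt0 // mulr_gt0.
pose U := closed_ball_ (fun x : 'rV[R]_N => `|x|) (K w0) rho.
have Uw s : U s -> `|om - B s - w0| <= 3 / 4 * mu.
  rewrite /U /closed_ball_ /= => Us.
  have -> : om - B s - w0 = (om - Phi w0) + B (K w0 - s).
    by rewrite (blinB _ _ bB) /Phi /straighten opprD !addrA subrK addrAC.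
  rewrite (le_trans (ler_normD _ _)) //.
  have -> : 3 / 4 * mu = mu / 4 + mu / 2 by lra.
  rewrite lerD ?(ltW omd) // (le_trans (bC _)) //.
  rewrite -ler_pdivlMl // (le_trans Us) //.
  by rewrite /rho invfM mulrA mulrC.
have Uw' s : U s -> `|om - B s - w0| < mu.
  by move=> /Uw/le_lt_trans; apply; move: mu0; clearbody mu; lra.
pose f s := K (om - B s).
have Kw q q' : `|q - w0| < mu -> `|q' - w0| < mu ->
    `|K q - K q'| <= (2 * C)^-1 * `|q - q'|.
  by rewrite !lt_min => /andP[qd _] /andP[q'd _]; exact: Hd.
have fU : set_fun U U f.
  move=> s Us; rewrite /U /closed_ball_ /= distrC.
  have w00 : `|w0 - w0| < mu by rewrite subrr normr0.
  apply: (le_trans (Kw _ _ (Uw' _ Us) w00)).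
  rewrite /rho mulrC ler_pM2r ?invr_gt0 ?mulr_gt0 //.
  by rewrite ltW // Uw'.
pose F : {fun U >-> U} := HB.pack f (isFun.Build _ _ U U f fU).
have half : 0 <= (2^-1 : R) by [].
have ctr : is_contraction F.
  exists (NngNum half); split; first by rewrite /= invf_lt1 // ltr1n.
  move=> [s s'] [/= Us Us']; rewrite /F /= /f.
  apply: (le_trans (Kw _ _ (Uw' _ Us) (Uw' _ Us'))).
  have -> : om - B s - (om - B s') = - B (s - s').
    by rewrite (blinB _ _ bB) !opprB addrC addrA subrK.
  rewrite normrN invfM -mulrA ler_pM2l // ler_pdivrMl //.
have [||s Us sE] := banach_fixed_point ctr.
- rewrite /U -closed_ballE //; exact: closed_ball_closed.
- by exists (K w0); rewrite /U /closed_ball_ /= subrr normr0 ltW.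
exists (om - B s).
  by have := Uw' _ Us; rewrite lt_min => /andP[].
by rewrite /Phi /straighten -/(K _) -[K _]sE subrK.
Qed.

Lemma straighten_near e : 0 < e ->
  \forall w \near w0, `|Phi w - Phi w0| < e.
Proof.
move=> e0; have [C C0 [bC [d d0 Hd]]] := defect.
apply/nearP_norm; exists (Num.min d (e / 2)) => [|w].
  by rewrite lt_min d0 divr_gt0.
rewrite lt_min => /andP[wd we].
have H1 : `|B ((H w - D w) - (H w0 - D w0))| <= 2^-1 * `|w - w0|.
  apply: (le_trans (bC _)); rewrite -ler_pdivlMl //.
  apply: (le_trans (Hd _ _ wd _)); first by rewrite subrr normr0.
  by rewrite invfM mulrA [C^-1 * _]mulrC.
have -> : Phi w - Phi w0 = (w - w0) + B ((H w - D w) - (H w0 - D w0)).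
  rewrite (blinB (H w - D w) (H w0 - D w0) bB) /Phi /straighten.
  by move: (B _) (B _) => x y; rewrite opprD addrACA.
move: H1; move: (w - w0) (B _) we => x y xe H1.
have := ler_normD x y; lra.
Qed.

(** Straightening maps the fibre of [H] into an affine subspace, so that a
    segment there pulls back to a path [Psi (om t)] inside the fibre. The path
    is only known to be Lipschitz; that suffices, because [k - lam \o H] has zero
    derivative at each of its points and equals [k] up to a constant on the
    fibre. *)
Lemma fibre_constant (k : V -> R^o) :
  (\forall w \near w0, exists E e (lam : 'rV[R]_N -> R^o),
     [/\ strict_deriv H w E, strict_deriv k w e, bounded_linear lam
       & forall v, e v = lam (E v)]) ->
  \forall w \near w0, H w = H w0 -> k w = k w0.
Proof.
move=> /nearP_norm[d1 d10 H1]; have [d2 d20 lip] := straighten_lip.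
have m0 : 0 < Num.min d1 d2 by rewrite lt_min d10.
have [d3 d30 onto] := straighten_onto m0.
have close : \forall w \near w0, `|Phi w - Phi w0| < d3 / 2.
  by apply: straighten_near; rewrite divr_gt0.
have close2 : \forall w \near w0, `|w - w0| < d2.
  by apply/nearP_norm; exists d2.
have /choice[Psi PsiP] (om : V) : exists w, `|om - Phi w0| < d3 ->
    `|w - w0| < Num.min d1 d2 /\ Phi w = om.
  have [h|h] := ltP `|om - Phi w0| d3; last by exists w0.
  by have [w ww Pw] := onto _ h; exists w.
near=> w => Hw.
have wd3 : `|Phi w - Phi w0| < d3 / 2 by near: w.
have wd2 : `|w - w0| < d2 by near: w.
have w0d2 : `|w0 - w0| < d2 by rewrite subrr normr0.
pose om (t : R) := Phi w0 + t *: (Phi w - Phi w0).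
have omE s t : om s - om t = (s - t) *: (Phi w - Phi w0).
  rewrite /om; move: (Phi w - Phi w0) => z.
  by rewrite opprD addrACA subrr add0r scalerBl.
have omd t : `|t| < 2 -> `|om t - Phi w0| < d3.
  move=> t2; rewrite /om addrC addKr normrZ.
  have [->|tn0] := eqVneq t 0; first by rewrite normr0 mul0r.
  have tp : 0 < `|t| by rewrite normr_gt0.
  rewrite -ltr_pdivlMl // (lt_trans wd3) // mulrC ltr_pM2r //.
  by rewrite ltf_pV2 // posrE.
have Psiom t : `|t| < 2 -> [/\ `|Psi (om t) - w0| < d1,
    `|Psi (om t) - w0| < d2 & Phi (Psi (om t)) = om t].
  by move=> /omd/PsiP[]; rewrite lt_min => /andP[].
have Hom t : `|t| < 2 -> H (Psi (om t)) = H w0.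
  move=> /Psiom[_ _ PsiE]; rewrite -straightenE -/Phi PsiE /om.
  rewrite (blinD _ _ sH.1) (blinZ _ _ sH.1) (blinB _ _ sH.1) !straightenE.
  by rewrite Hw subrr scaler0 addr0.
have uniqP t x : `|t| < 2 -> `|x - w0| < d2 -> om t = Phi x -> Psi (om t) = x.
  move=> t2 xd omx; have [_ Pd2 PE] := Psiom t t2.
  have := lip _ _ Pd2 xd; rewrite PE omx subrr normr0 mulr0.
  by rewrite normr_le0 subr_eq0 => /eqP; rewrite -omx.
have n0 : `|0 : R| < 2 by rewrite normr0.
have n1 : `|1 : R| < 2 by rewrite normr1 ltr1n.
have P1 : Psi (om 1) = w.
  by apply: uniqP => //; rewrite /om scale1r addrC subrK.
have P0 : Psi (om 0) = w0.
  by apply: uniqP => //; rewrite /om scale0r addr0.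
(* The path is defined for |t| < 2, beyond the unit interval, so that the
   derivatives at the end points are two-sided. *)
pose F (t : R) : R := k (Psi (om t)).
suff : `|F 1 - F 0| <= 0.
  by rewrite normr_le0 subr_eq0 /F P1 P0 => /eqP.
apply: (@mean_value_real _ _ (fun=> 0)) => t /andP[t0 t1]; split.
  by rewrite normr0.
have t2 : `|t| < 2 by rewrite ger0_norm // (le_lt_trans t1) // ltr1n.
move=> e e0; have [Pd1 Pd2 PE] := Psiom t t2.
have [E [e' [lam [sE se' blam lamE]]]] := H1 _ Pd1.
have [bG sG] := sd_sub se' (sd_comp sE (sd_lin (H (Psi (om t))) blam)).
have c0 : 0 < 2 * `|Phi w - Phi w0| + 1 by rewrite ltr_wpDl // mulr_ge0.
have [d4 d40 H4] := sG (e / (2 * `|Phi w - Phi w0| + 1)) (divr_gt0 e0 c0).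
exists (Num.min (d4 / (2 * `|Phi w - Phi w0| + 1)) (2 - `|t|)) => [|s].
  by rewrite lt_min divr_gt0 // subr_gt0.
rewrite lt_min => /andP[sd4 sd2].
have s2 : `|s| < 2.
  rewrite -(subrK t s) (le_lt_trans (ler_normD _ _)) //.
  by rewrite -ltrBrDr.
have [Qd1 Qd2 QE] := Psiom s s2.
have lip' : `|Psi (om s) - Psi (om t)| <= 2 * (`|s - t| * `|Phi w - Phi w0|).
  by rewrite -normrZ -omE -{2}QE -{2}PE; exact: lip.
have {}lip' : `|Psi (om s) - Psi (om t)| <=
    `|s - t| * (2 * `|Phi w - Phi w0| + 1).
  by apply: (le_trans lip'); rewrite mulrCA ler_wpM2l // lerDl.
have clo : `|Psi (om s) - Psi (om t)| < d4.
  by apply: (le_lt_trans lip'); rewrite -ltr_pdivlMr.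
have := H4 (Psi (om s)) (Psi (om t)) clo; rewrite subrr normr0 => /(_ d40).
rewrite lamE subrr subr0 !Hom // opprB addrA subrK => H5.
rewrite mulr0 subr0 /F; apply: (le_trans H5).
by rewrite -mulrA [_^-1 * _]mulrC ler_wpM2l ?(ltW e0) // ler_pdivrMr.
Unshelve. all: by end_near. Qed.

End Straighten.

Lemma right_inverse V N (D : V -> 'rV[R]_N) : bounded_linear D ->
  (forall s, exists v, D v = s) ->
  exists2 B : 'rV[R]_N -> V, bounded_linear B & cancel B D.
Proof.
move=> bD ontoD.
have /choice[b Db] (i : 'I_N) : exists v, D v = delta_mx 0 i by exact: ontoD.
exists (fun s => \sum_i s 0 i *: b i) => [|s].
  apply: linear_bounded_basis; first exact: bounded_basis_mx.
  move=> c u v; rewrite scaler_sumr -big_split /=; apply: eq_bigr => i _.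
  by rewrite !mxE scalerDl scalerA.
rewrite (blin_sum _ _ bD) [RHS]row_sum_delta; apply: eq_bigr => i _.
by rewrite (blinZ _ _ bD) Db.
Qed.

(** For a relation [c] between the components of [E], the entry [c 0 i] is the
    value of the functional on [(D - E) (B e_i)], which is small compared with
    [c]. *)
Lemma independent_near V N (H : V -> 'rV[R]_N) w0 D B :
  strict_deriv H w0 D -> bounded_linear B -> cancel B D ->
  \forall w \near w0, forall E, strict_deriv H w E ->
    forall c : 'rV[R]_N, (forall v, \sum_i c 0 i * E v 0 i = 0) -> c = 0.
Proof.
move=> sH bB BK; have [C C0 bC] := bB.2.
pose e : R := (2 * (N%:R + 1) * C)^-1.
have N1 : (0 : R) < N%:R + 1 by rewrite ltr_wpDl.
have e0 : 0 < e by rewrite invr_gt0 !mulr_gt0.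
have := sd_deriv_near sH e0; apply: filterS => w Hw E /Hw Ed c cE.
apply/eqP; rewrite -normr_le0.
suff : `|c| <= 2^-1 * `|c| by lra.
apply: mx_norm_leP => [|i0 i]; first by rewrite mulr_ge0.
rewrite {i0}ord1.
pose v : V := B (delta_mx 0 i).
have -> : c 0 i = \sum_k c 0 k * (D v - E v) 0 k.
  under eq_bigr do rewrite !mxE mulrBr.
  rewrite sumrB cE subr0 /v BK (bigD1 i) //= mxE !eqxx mulr1 big1 ?addr0 // => k ki.
  by rewrite mxE (negbTE ki) andbF mulr0.
have v1 : `|v| <= C.
  apply: (le_trans (bC _)); rewrite ler_piMr ?(ltW C0) //.
  apply: mx_norm_leP => // k l; rewrite mxE.
  by case: (_ && _); rewrite ?normr1 ?normr0.
apply: (le_trans (ler_norm_sum _ _ _)).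
apply: (@le_trans _ _ (\sum_(k < N) `|c| * (e * C))).
  apply: ler_sum => k _; rewrite normrM ler_pM ?mx_entry_le //.
  apply: (le_trans (mx_entry_le _ _ _)); rewrite distrC.
  by apply: (le_trans (Ed v)); rewrite ler_pM2l.
rewrite sumr_const card_ord -[_ *+ N]mulr_natl mulrCA mulrC ler_wpM2r //.
rewrite /e !invfM divfK ?gt_eqF // mulrCA -[leRHS]mulr1 ler_wpM2l //.
by rewrite ler_pdivrMr // mul1r lerDl.
Qed.
End LocalTheory.

(** * Independent functionals *)

Section LinearAlgebra.
Import VectorInternalTheory.

Lemma dual_onto (K : fieldType) (V : vectType K) N (D : {linear V -> 'rV[K]_N}) :
  (forall c : 'rV[K]_N, (forall v, \sum_i c 0 i * D v 0 i = 0) -> c = 0) ->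
  forall s, exists v, D v = s.
Proof.
move=> indep.
pose M := lin1_mx (D \o r2v).
have DM v : D v = v2r v *m M by rewrite mul_rV_lin1 /= v2rK.
have : row_full M.
  rewrite /row_full -mxrank_tr; apply: inj_row_free => c cM; apply: indep => v.
  have : (v2r v *m M *m c^T) 0 0 = 0.
    by rewrite -mulmxA -[M]trmxK -trmx_mul cM trmx0 mulmx0 mxE.
  rewrite -DM mxE => E; rewrite -[RHS]E; apply: eq_bigr => i _.
  by rewrite mxE mulrC.
move=> /row_fullP[B BM] s; exists (r2v (s *m B)).
by rewrite DM r2vK -mulmxA BM mulmx1.
Qed.

Lemma span_select (K : fieldType) (V : vectType K) (I : eqType) (X : I -> V)
    (s : seq I) :
  exists s', [/\ {subset s' <= s}, free [seq X i | i <- s']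
    & forall i, i \in s -> X i \in <<[seq X i | i <- s']>>%VS].
Proof.
elim: s => [|i s [s' [ss' fs' ps']]].
  by exists [::]; split=> //; rewrite /= nil_free.
have [Xi|Xi] := boolP (X i \in <<[seq X i | i <- s']>>%VS).
  exists s'; split=> // [j /ss' js|j]; first by rewrite inE js orbT.
  by rewrite inE => /orP[/eqP ->|/ps'].
exists (i :: s'); split=> [j||j].
- by rewrite !inE => /orP[->//|/ss' ->]; rewrite orbT.
- by rewrite /= free_cons Xi.
- rewrite inE => /orP[/eqP ->|/ps' Xj]; first by rewrite memv_span // inE eqxx.
  by rewrite /= span_cons; apply: (subvP (addvSr _ _)).
Qed.

End LinearAlgebra.

(** * Continuous differentiability near a point *)

Section C1Near.
Context {R : realType}.
Implicit Types V W Z : normedModType R.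

(** Strict differentiability at all nearby points: besides the strict
    derivative at [w] itself, which is the case [q = w], this is what the
    argument with constant rank uses. *)
Definition C1_near V W (h : V -> W) (w : V) : Prop :=
  \forall q \near w, exists D, strict_deriv h q D.

Lemma C1_near_strict V W (h : V -> W) w :
  C1_near h w -> strict_deriv h w ('d h w).
Proof. by move=> /nbhs_singleton[D sD]; have [_ ->] := sd_diff sD. Qed.

Lemma sd_continuous V W (h : V -> W) w D :
  strict_deriv h w D -> {for w, continuous h}.
Proof. by move=> /sd_diff[/differentiable_continuous]. Qed.

Lemma C1_near_comp V W Z (h : V -> W) (k : W -> Z) w :
  C1_near h w -> C1_near k (h w) -> C1_near (fun q => k (h q)) w.
Proof.
move=> ch ck; have hc := sd_continuous (C1_near_strict ch).
have := hc _ ck; rewrite /= => ck'; near=> q.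
have [D sD] : exists D, strict_deriv h q D by near: q.
have [E sE] : exists E, strict_deriv k (h q) E by near: q.
by exists (fun v => E (D v)); exact: sd_comp.
Unshelve. all: by end_near. Qed.

Lemma C1_near_pair V W Z (h : V -> W) (k : V -> Z) w :
  C1_near h w -> C1_near k w -> C1_near (fun q => (h q, k q)) w.
Proof.
move=> ch; apply: filterS2 ch => q [D sD] [E sE].
by exists (fun v => (D v, E v)); exact: sd_pair.
Qed.

Lemma C1_near_row V m n (h : V -> 'I_m -> 'rV[R]_n) w :
  (forall i, C1_near (h^~ i) w) ->
  C1_near (fun q => \matrix_(i < m) h q i) w.
Proof.
move=> ch.
have : \forall q \near w, forall i, exists D, strict_deriv (h^~ i) q D.
  exact: filter_forall.
apply: filterS => q /choice[D sD].
exists (fun v => \matrix_(i < m) D i v).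
exact: (@sd_row R V m n h q (fun v i => D i v)).
Qed.

Lemma C1_near_all V W (h : V -> W) w : (forall q, exists D, strict_deriv h q D) ->
  C1_near h w.
Proof. by move=> H; apply: nearW. Qed.

End C1Near.

(** * Shifts and finite windows *)

Section Shifts.
Context {R : realType} {n m : nat}.
Implicit Types p : tpoint R n m.

(** The shift for arbitrary maps in place of those of a system, so that it also
    covers the linearization. *)
Definition gstep (f : 'rV[R]_n * 'rV[R]_m -> 'rV[R]_n)
    (g : 'rV[R]_n * 'rV[R]_m -> 'rV[R]_m) p : tpoint R n m :=
  let xu := (state p, input p 0%N) in
  TPoint (fun b => if b is b'.+1 then past p b' else g xu) (f xu)
         (fun k => input p k.+1).

Lemma stepE (S : dsystem R n m) : step S = gstep (sys_f S) (sys_g S).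
Proof. by []. Qed.

Definition agree lz lu p p' : Prop :=
  [/\ forall b, (b < lz)%N -> past p b = past p' b, state p = state p'
    & forall k, (k < lu)%N -> input p k = input p' k].

Lemma agree_iter f g lz lu k p p' : agree lz (lu + k) p p' ->
  agree lz lu (iter k (gstep f g) p) (iter k (gstep f g) p').
Proof.
elim: k lu => [|k IHk] lu; first by rewrite addn0.
rewrite addnS -addSn => /IHk[Hp Hs Hi]; split=> [[_|b /ltnW Hb]||i Hi'] /=.
- by rewrite Hs Hi.
- exact: Hp.
- by rewrite Hs Hi.
- exact: Hi.
Qed.

Lemma agree_window lz lu p p' : agree lz lu.+1 p p' ->
  window_of lz lu p = window_of lz lu p'.
Proof.
move=> [Hp Hs Hi]; rewrite /window_of Hs; congr (_, _, _).
  by apply/matrixP => i j; rewrite !mxE Hp.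
by apply/matrixP => i j; rewrite !mxE Hi.
Qed.

Lemma agree_sub lz lu lz' lu' p p' : (lz' <= lz)%N -> (lu' <= lu)%N ->
  agree lz lu p p' -> agree lz' lu' p p'.
Proof.
move=> hz hu [Hp Hs Hi]; split=> // [b hb|k hk].
  by apply: Hp; exact: leq_trans hz.
by apply: Hi; exact: leq_trans hu.
Qed.

Lemma input_iter f g k p i : input (iter k (gstep f g) p) i = input p (i + k).
Proof.
elim: k i => [|k IHk] i; first by rewrite addn0.
by rewrite iterS /= IHk addSnnS.
Qed.

Lemma past_iter f g k p b : past (iter k (gstep f g) p) b =
  if (b < k)%N then
    let p' := iter (k - b.+1) (gstep f g) p in g (state p', input p' 0%N)
  else past p (b - k).
Proof.
elim: k b => [|k IHk] b; first by rewrite subn0.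
rewrite iterS /=; case: b => [|b]; first by rewrite subn1.
by rewrite IHk ltnS subSS.
Qed.

Lemma of_windowK (S : dsystem R n m) lz lu p :
  agree lz lu.+1 (of_window S (window_of lz lu p)) p.
Proof.
split=> // [b hb|k hk]; rewrite /of_window /= insubT /=;
  by apply/rowP => j; rewrite !mxE.
Qed.

Lemma of_window_eq (S : dsystem R n m) lz lu :
  of_window S (window_of lz lu (tpoint_eq S)) = tpoint_eq S.
Proof.
rewrite /of_window /tpoint_eq /=; congr TPoint; apply/funext => b;
  by case: insubP => // i _ _; apply/rowP => j; rewrite !mxE.
Qed.

Lemma step_eq (S : dsystem R n m) : step S (tpoint_eq S) = tpoint_eq S.
Proof.
rewrite /step /tpoint_eq /= sys_equilibrium; congr TPoint.
by apply/funext => -[].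
Qed.

Lemma iter_step_eq (S : dsystem R n m) k :
  iter k (step S) (tpoint_eq S) = tpoint_eq S.
Proof. by elim: k => // k IHk; rewrite iterS IHk step_eq. Qed.

Lemma yshiftE (S : dsystem R n m) q1 q2 (phi : window R n m q1 q2 -> 'rV[R]_m) j k p :
  yshift S phi j k p = phi (window_of q1 q2 (iter k (step S) p)) 0 j.
Proof.
elim: k p => [//|k IHk] p.
by rewrite iterSr -IHk.
Qed.

Lemma yshift_iter (S : dsystem R n m) q1 q2 (phi : window R n m q1 q2 -> 'rV[R]_m)
  j k l p : yshift S phi j k (iter l (step S) p) = yshift S phi j (k + l) p.
Proof. by rewrite !yshiftE -iterD. Qed.

Lemma yshift_agree (S : dsystem R n m) q1 q2 (phi : window R n m q1 q2 -> 'rV[R]_m)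
  j k p p' : agree q1 (q2 + k).+1 p p' -> yshift S phi j k p = yshift S phi j k p'.
Proof.
rewrite -addSn !yshiftE stepE => /(agree_iter (sys_f S) (sys_g S))/agree_window -> //.
Qed.

(** The padding of a tangent window is zero, the derivative of the constant
    padding of [of_window]. *)
Definition of_window0 lz lu (v : window R n m lz lu) : tpoint R n m :=
  TPoint (fun b => if insub b is Some i then row i v.1.1 else 0)
         v.1.2
         (fun k => if insub k is Some i then row i v.2 else 0).

Lemma of_window0K lz lu p : agree lz lu.+1 (of_window0 (window_of lz lu p)) p.
Proof.
split=> // [b hb|k hk]; rewrite /of_window0 /= insubT /=;
  by apply/rowP => j; rewrite !mxE.
Qed.

Lemma near_eq_window (S : dsystem R n m) lz lu e : 0 < e ->
  \forall w \near window_of lz lu (tpoint_eq S), near_eq S e (of_window S w).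
Proof.
move=> e0; apply/nearP_norm; exists e => // w we.
have H : forall k l (M N : 'M[R]_(k, l)) i c, `|M - N| < e -> row i N = c ->
    `|row i M - c| < e.
  move=> k l M N i c MN <-; rewrite -linearB; apply: le_lt_trans MN.
  by apply: mx_norm_leP => // i' j; rewrite mxE mx_entry_le.
have w1 := le_lt_trans (fst_norm_le _) we.
split=> [b||k] /=.
- case: insubP => [i _ _|_]; last by rewrite subrr normr0.
  apply: (H _ _ _ _ _ _ (le_lt_trans (fst_norm_le _) w1)).
  by apply/rowP => j; rewrite !mxE.
- exact: (le_lt_trans (snd_norm_le _) w1).
- case: insubP => [i _ _|_]; last by rewrite subrr normr0.
  apply: (H _ _ _ _ _ _ (le_lt_trans (snd_norm_le _) we)).
  by apply/rowP => j; rewrite !mxE.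
Qed.

End Shifts.

(** * Polynomials in the shift operator *)

Section PolynomialAction.
Context {R : comNzRingType}.
Implicit Types (p q : {poly R}) (s : nat -> R).

(** The value at time 0 of [p], a polynomial in the shift, applied to [s]. *)
Definition pact p s : R := \sum_(l < size p) p`_l * s l.

Lemma pact_wide k p s : (size p <= k)%N -> pact p s = \sum_(l < k) p`_l * s l.
Proof.
move=> pk; rewrite /pact (big_ord_widen k (fun l => p`_l * s l)) // big_mkcond /=.
apply: eq_bigr => l _; case: ltnP => // hl.
by rewrite nth_default ?mul0r.
Qed.

Lemma pactD p q s : pact (p + q) s = pact p s + pact q s.
Proof.
rewrite (pact_wide _ (size_polyD p q)) (pact_wide _ (leq_maxl (size p) (size q))).
rewrite (pact_wide _ (leq_maxr (size p) (size q))) -big_split /=.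
by apply: eq_bigr => l _; rewrite coefD mulrDl.
Qed.

Lemma pact0 s : pact 0 s = 0.
Proof. by rewrite /pact size_poly0 big_ord0. Qed.

Lemma pact_sum (I : Type) (r : seq I) (P : pred I) (F : I -> {poly R}) s :
  pact (\sum_(i <- r | P i) F i) s = \sum_(i <- r | P i) pact (F i) s.
Proof.
exact: (big_morph (pact^~ s) (fun p q => pactD p q s) (pact0 s)).
Qed.

Lemma pactZ c p s : pact (c *: p) s = c * pact p s.
Proof.
rewrite (pact_wide _ (size_scale_leq c p)) mulr_sumr.
by apply: eq_bigr => l _; rewrite coefZ mulrA.
Qed.

Lemma pactXn k s : pact 'X^k s = s k.
Proof.
rewrite /pact size_polyXn big_ord_recr /= coefXn eqxx mul1r big1 ?add0r //.
by move=> l _; rewrite coefXn ltn_eqF // mul0r.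
Qed.

Lemma pact_seq_sum (I : finType) p (F : I -> nat -> R) :
  pact p (fun k => \sum_i F i k) = \sum_i pact p (F i).
Proof.
rewrite /pact exchange_big /=; apply: eq_bigr => l _.
by rewrite mulr_sumr.
Qed.

Lemma pact_ext p s s' : s =1 s' -> pact p s = pact p s'.
Proof. by move=> E; apply: eq_bigr => l _; rewrite E. Qed.

Lemma pactM p q s :
  pact (p * q) s = pact p (fun k => pact q (fun l => s (k + l)%N)).
Proof.
elim/poly_ind: p s => [|p c IHp] s; first by rewrite mul0r !pact0.
have mulX q' s' : pact (q' * 'X) s' = pact q' (fun l => s' l.+1).
  rewrite (pact_wide (k := (size q').+1)); last first.
    by rewrite (leq_trans (size_polyMleq _ _)) // size_polyX addn2.
  by rewrite big_ord_recl coefMX mul0r add0r; apply: eq_bigr => l _;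
     rewrite coefMX.
have constM q' s' : pact (c%:P * q') s' = c * pact q' s'.
  by rewrite mul_polyC pactZ.
have one s' : pact (1 : {poly R}) s' = s' 0%N by rewrite -(expr0 'X) pactXn.
rewrite mulrDl !pactD constM mulrAC !mulX IHp -[c%:P]mulr1 constM one.
by congr (_ + _).
Qed.

End PolynomialAction.

(** Any row is related to the rows of a square matrix, over any domain: if [P] is
    singular its own rows are related, otherwise the adjugate clears the
    denominators of [c] times the inverse of [P]. *)
Lemma poly_relation (R : idomainType) m (P : 'M[R]_m) (c : 'rV[R]_m) :
  c != 0 -> exists d s, d != 0 /\ d *m P = s *: c.
Proof.
move=> c0; have [/det0P[v v0 vP]|detP] := boolP (\det P == 0).
  by exists v, 0; rewrite scale0r.
exists (c *m \adj P), (\det P).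
have E : c *m \adj P *m P = \det P *: c.
  by rewrite -mulmxA mul_adj_mx mul_mx_scalar.
split=> //; apply: contra_neq c0 => dc0.
apply/rowP => j; have /matrixP/(_ 0 j)/eqP := E.
by rewrite dc0 mul0mx !mxE eq_sym mulf_eq0 (negbTE detP) => /eqP.
Qed.

(** * Independence of the shifts of the flat output *)

Section LinearShifts.
Context {R : realType} {n m : nat}.
Variables (f' : 'rV[R]_n * 'rV[R]_m -> 'rV[R]_n).
Variables (g' : 'rV[R]_n * 'rV[R]_m -> 'rV[R]_m).
Variables (q1 q2 : nat) (phi' : window R n m q1 q2 -> 'rV[R]_m).
Implicit Types xi : tpoint R n m.

Let T := gstep f' g'.

(** With the derivatives at the equilibrium for [f'], [g'] and [phi'], this is
    the differential of the [k]-th shift of the [j]-th flat output. *)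
Definition lshift (j : 'I_m) (k : nat) xi : R :=
  phi' (window_of q1 q2 (iter k T xi)) 0 j.

Lemma lshift_iter j k l xi : lshift j k (iter l T xi) = lshift j (l + k) xi.
Proof. by rewrite /lshift -iterD addnC. Qed.

Lemma lshift_agree j k xi xi' : agree q1 (q2 + k).+1 xi xi' ->
  lshift j k xi = lshift j k xi'.
Proof.
by rewrite /lshift -addSn => /(agree_iter f' g')/agree_window ->.
Qed.

Definition ljet (d : 'I_m -> nat) xi : 'rV[R]_#|{: {j : 'I_m & 'I_(d j)}}| :=
  \row_i (let t : {j : 'I_m & 'I_(d j)} := enum_val i in
          lshift (tag t) (tagged t) xi).

(** A functional [c] on jets, seen as one polynomial in the shift for each
    component of the flat output. *)
Definition jpoly (d : 'I_m -> nat) (c : 'rV[R]_#|{: {j : 'I_m & 'I_(d j)}}|)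
    (j : 'I_m) : {poly R} :=
  \sum_(l < d j) c 0 (enum_rank (Tagged (fun j => 'I_(d j)) l)) *: 'X^l.

Definition yact (c : 'rV[{poly R}]_m) xi : R :=
  \sum_j pact (c 0 j) (fun l => lshift j l xi).

Lemma jpolyE d (c : 'rV[R]_#|{: {j : 'I_m & 'I_(d j)}}|) xi : \sum_i c 0 i * ljet d xi 0 i =
  yact (\row_j jpoly c j) xi.
Proof.
pose F (t : {j : 'I_m & 'I_(d j)}) := c 0 (enum_rank t) * lshift (tag t) (tagged t) xi.
transitivity (\sum_t F t).
  rewrite (reindex (@enum_val {: {j : 'I_m & 'I_(d j)}} predT)) /=; last first.
    exact: onW_bij (@enum_val_bij _).
  by apply: eq_bigr => i _; rewrite !mxE /F enum_valK.
rewrite (eq_bigr (fun t => F (Tagged (fun j => 'I_(d j)) (tagged t)))); last by case.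
rewrite -(@sig_big_dep R 0 +%R 'I_m (fun j => 'I_(d j)) predT (fun=> predT)
  (fun j l => F (Tagged (fun j => 'I_(d j)) l))) /=.
rewrite /yact; apply: eq_bigr => j _.
rewrite mxE pact_sum; apply: eq_bigr => l _.
by rewrite pactZ pactXn.
Qed.

Lemma jpoly_eq0 d (c : 'rV[R]_#|{: {j : 'I_m & 'I_(d j)}}|) :
  \row_j jpoly c j = 0 -> c = 0.
Proof.
move=> /rowP c0; apply/rowP => i; rewrite mxE -(enum_valK i).
case: (enum_val i) => j l; have := c0 j; rewrite !mxE => /polyP/(_ l).
rewrite coef0 coef_sum (bigD1 l) //= coefZ coefXn eqxx mulr1 big1 ?addr0 //.
by move=> l' l'l; rewrite coefZ coefXn eq_sym (inj_eq val_inj) (negbTE l'l) mulr0.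
Qed.


Lemma yactZ q c xi : yact (q *: c) xi =
  pact q (fun k => yact c (iter k T xi)).
Proof.
rewrite /yact pact_seq_sum; apply: eq_bigr => j _.
rewrite mxE pactM; apply: pact_ext => k; apply: pact_ext => l.
by rewrite lshift_iter.
Qed.

Section Flat.
Variable r : 'I_m -> nat.
Variable Fu : 'rV[R]_#|{: {j : 'I_m & 'I_(r j).+1}}| -> 'rV[R]_m.
Hypothesis bFu : bounded_linear Fu.
Hypothesis FuE : forall xi, Fu (ljet (fun j => (r j).+1) xi) = input xi 0%N.

(** The inputs are [P y]; a relation [c] between the shifts of [y] would turn,
    through [poly_relation], into a relation [d] between the shifts of the inputs.
    The trajectory with a single unit input at time [k] shows that each
    coefficient of [d] vanishes. *)
Lemma flat_independent c : (forall xi, yact c xi = 0) -> c = 0.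
Proof.
move=> c_rel; apply/eqP; apply: contraT => c0.
pose P : 'M[{poly R}]_m := \matrix_(i, j)
  jpoly (\row_k Fu (delta_mx 0 k) 0 i : 'rV_#|{: {j : 'I_m & 'I_(r j).+1}}|) j.
have [d [s [d0 dP]]] := poly_relation P c0.
have uE xi i : input xi 0%N 0 i = yact (row i P) xi.
  rewrite -FuE (row_sum_delta (ljet _ xi)) (blin_sum _ _ bFu) summxE.
  have -> : row i P = \row_j jpoly (\row_k Fu (delta_mx 0 k) 0 i) j.
    by apply/rowP => j; rewrite !mxE.
  rewrite -jpolyE; apply: eq_bigr => k _.
  by rewrite (blinZ _ _ bFu) !mxE mulrC.
have ukE xi k i : input xi k 0 i = yact (row i P) (iter k T xi).
  by rewrite -uE input_iter.
have uact xi : \sum_i pact (d 0 i) (fun k => input xi k 0 i) = 0.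
  transitivity (yact (d *m P) xi).
    rewrite /yact; under [RHS]eq_bigr do rewrite mxE pact_sum.
    rewrite exchange_big /=; apply: eq_bigr => i _.
    under pact_ext do rewrite ukE.
    rewrite /yact pact_seq_sum; apply: eq_bigr => j _.
    rewrite pactM mxE; apply: pact_ext => k; apply: pact_ext => l.
    by rewrite lshift_iter.
  rewrite dP yactZ; under pact_ext do rewrite c_rel.
  by rewrite /pact big1 // => l _; rewrite mulr0.
case/eqP: d0; apply/rowP => i; apply/polyP => k; rewrite mxE coef0.
have := uact (TPoint (fun=> 0) 0 (fun l => if l == k then delta_mx 0 i else 0)).
rewrite (bigD1 i) //= [X in _ + X]big1 ?addr0; last first.
  move=> j ji; rewrite /pact big1 // => l _.
  by case: eqP => _; rewrite !mxE ?(negbTE ji) ?andbF ?mulr0n mulr0.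
have [kd|kd] := ltnP k (size (d 0 i)); last by rewrite nth_default.
rewrite /pact (bigD1 (Ordinal kd)) //= eqxx mxE !eqxx mulr1 big1 ?addr0 // => l lk.
by rewrite ifN ?mxE ?mulr0 //; apply: contra lk => /eqP lk; apply/eqP/val_inj.
Qed.

End Flat.

End LinearShifts.

(** * What the inputs of the linearized system reach *)

Section LinearControl.
Context {R : realType} {n m : nat}.
Variables (f' : 'rV[R]_n * 'rV[R]_m -> 'rV[R]_n).
Variables (g' : 'rV[R]_n * 'rV[R]_m -> 'rV[R]_m).
Variables (q1 q2 : nat) (phi' : window R n m q1 q2 -> 'rV[R]_m).
Hypotheses (bf : bounded_linear f') (bg : bounded_linear g').
Hypothesis bphi : bounded_linear phi'.
Implicit Types xi : tpoint R n m.

Let T := gstep f' g'.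
Let y := lshift f' g' phi'.

Lemma y_iter j k l xi : y j k (iter l T xi) = y j (l + k) xi.
Proof. exact: lshift_iter. Qed.

Definition tcomb c xi xi' : tpoint R n m :=
  TPoint (fun b => c *: past xi b + past xi' b) (c *: state xi + state xi')
         (fun k => c *: input xi k + input xi' k).

Lemma iter_tcomb k c xi xi' :
  iter k T (tcomb c xi xi') = tcomb c (iter k T xi) (iter k T xi').
Proof.
elim: k => // k IHk; rewrite !iterS IHk /T /gstep /tcomb /=; congr TPoint.
  by apply/funext => -[|b] //; rewrite -bg.1.
by rewrite -bf.1.
Qed.

Lemma lshift_comb j k c xi xi' : y j k (tcomb c xi xi') = c * y j k xi + y j k xi'.
Proof.
rewrite /y /lshift -/T iter_tcomb.
have -> : window_of q1 q2 (tcomb c (iter k T xi) (iter k T xi')) =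
    c *: window_of q1 q2 (iter k T xi) + window_of q1 q2 (iter k T xi').
  rewrite /window_of /=; congr (_, _, _); apply/matrixP => i i';
  by rewrite !mxE.
by rewrite bphi.1 !mxE.
Qed.

Lemma of_window0_comb lz lu c (v v' : window R n m lz lu) :
  of_window0 (c *: v + v') = tcomb c (of_window0 v) (of_window0 v').
Proof.
rewrite /of_window0 /tcomb /=; congr TPoint; apply/funext => k;
  by case: insubP => [i _ _|_]; rewrite ?linearP // scaler0 addr0.
Qed.

Lemma ljet_blin lz lu (d : 'I_m -> nat) :
  bounded_linear (fun v : window R n m lz lu => ljet f' g' phi' d (of_window0 v)).
Proof.
apply: linear_bounded_basis.
  by do 2?apply: bounded_basis_pair; exact: bounded_basis_mx.
move=> c u v; apply/rowP => i; rewrite of_window0_comb !mxE.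
exact: lshift_comb.
Qed.

Variables (r a : 'I_m -> nat).
Variable Fx : 'rV[R]_#|{: {j : 'I_m & 'I_(r j)}}| -> 'rV[R]_n.
Variable Fu : 'rV[R]_#|{: {j : 'I_m & 'I_(r j).+1}}| -> 'rV[R]_m.
Hypotheses (bFx : bounded_linear Fx) (bFu : bounded_linear Fu).
Hypothesis FxE : forall xi, Fx (ljet f' g' phi' r xi) = state xi.
Hypothesis FuE : forall xi,
  Fu (ljet f' g' phi' (fun j => (r j).+1) xi) = input xi 0%N.

(** The dual form of [flat_independent]; the window is large enough for all the
    shifts involved to be functions of it. *)
Lemma lshift_onto K (tau : 'I_m -> nat -> R) :
  exists xi, forall j l, (l < K)%N -> y j l xi = tau j l.
Proof.
pose d (j : 'I_m) := K.
pose D (v : window R n m q1 (q2 + K)) := ljet f' g' phi' d (of_window0 v).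
have [L DL _] := blin_linear (ljet_blin q1 (q2 + K) d).
have onto : forall s, exists v, L v = s.
  apply: dual_onto => c c0; apply: jpoly_eq0.
  apply: (flat_independent bFu FuE) => xi; rewrite -jpolyE.
  rewrite -[RHS](c0 (window_of q1 (q2 + K) xi)) -DL; apply: eq_bigr => i _.
  congr (_ * _); rewrite !mxE; apply/esym/lshift_agree.
  apply: (@agree_sub _ _ _ q1 (q2 + K).+1) => //; last exact: of_window0K.
  by rewrite ltnS leq_add2l ltnW.
pose s : 'rV[R]_#|{: {j : 'I_m & 'I_(d j)}}| :=
  \row_i (let t : {j : 'I_m & 'I_(d j)} := enum_val i in tau (tag t) (tagged t)).
have [v vs] := onto s; exists (of_window0 v) => j l lK.
pose t : {j : 'I_m & 'I_(d j)} := @Tagged _ j (fun j => 'I_(d j)) (Ordinal lK).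
have := congr1 (fun M : 'rV[R]_#|{: {j : 'I_m & 'I_(d j)}}| => M 0 (enum_rank t)) vs.
by rewrite /= -DL !mxE enum_rankK.
Qed.

(** Keep the flat output at zero long enough for [Fx] and [Fu] to force the
    state and the last [q1] values of zeta to vanish after [q1] steps, and start
    from there. *)
Lemma lshift_high_onto K (tau : 'I_m -> nat -> R) :
  exists u, forall j l, (l < K)%N ->
    y j l (TPoint (fun=> 0) 0 u) = if (l < r j)%N then 0 else tau j l.
Proof.
pose M := (q1 + (K + \max_j r j)).+1%N.
have [xi xiE] := lshift_onto M
  (fun j l => if (l < q1 + r j)%N then 0 else tau j (l - q1)%N).
have rM j : (r j <= \max_j r j)%N by exact: leq_bigmax.
have jet0 d k : (forall j, k + d j <= q1 + r j)%N ->
    ljet f' g' phi' d (iter k T xi) = 0.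
  move=> dk; apply/rowP => i; rewrite !mxE.
  case: (enum_val i) => j [l ld] /=; rewrite -/y y_iter.
  have kl : (k + l < q1 + r j)%N by rewrite (leq_trans _ (dk j)) // ltn_add2l.
  by rewrite xiE ?kl // ltnS (leq_trans (ltnW kl)) // leq_add2l
             (leq_trans (rM j)) // leq_addl.
have state0 k : (k <= q1)%N -> state (iter k T xi) = 0.
  move=> kq; rewrite -FxE jet0 ?(blin0 bFx) // => j.
  by rewrite leq_add2r.
have input0 k : (k < q1)%N -> input (iter k T xi) 0%N = 0.
  move=> kq; rewrite -FuE jet0 ?(blin0 bFu) // => j.
  by rewrite addnS -addSn leq_add2r.
exists (input (iter q1 T xi)) => j l lK.
have -> : y j l (TPoint (fun=> 0) 0 (input (iter q1 T xi))) =
    y j l (iter q1 T xi).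
  apply: lshift_agree; split=> [b bq||//] /=; last by rewrite state0.
  rewrite past_iter bq /=; set k := (q1 - b.+1)%N.
  have kq : (k < q1)%N by rewrite /k; lia.
  by rewrite state0 ?(ltnW kq) // input0 // [RHS](blin0 bg).
rewrite y_iter xiE; last first.
  by rewrite ltnS leq_add2l (leq_trans (ltnW lK)) // leq_addr.
by rewrite ltn_add2l addKn.
Qed.

Hypothesis past_free : forall xi,
  (forall (j : 'I_m) b, (b < q1 - a j)%N -> past xi b 0 j = 0) ->
  state xi = 0 -> (forall k, input xi k = 0) ->
  forall j, (a j < r j)%N -> y j (a j) xi = 0.

Hypothesis listed_onto : forall tau : 'I_m -> nat -> R, exists xi,
  [/\ forall (j : 'I_m) b, (b < q1 - a j)%N -> past xi b 0 j = 0, state xi = 0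
    & forall j l, (a j <= l < r j)%N -> y j l xi = tau j l].

(** Shifting a trajectory that is zero except for its unlisted past keeps it so:
    the entries that move into the past are zero. *)
Lemma past_free_iter xi :
  (forall (j : 'I_m) b, (b < q1 - a j)%N -> past xi b 0 j = 0) ->
  state xi = 0 -> (forall k, input xi k = 0) ->
  forall j l, (a j <= l < r j)%N -> y j l xi = 0.
Proof.
move=> pxi sxi ixi j l /andP[al lr].
have state0 k : state (iter k T xi) = 0.
  elim: k => // k IHk; rewrite iterS /= IHk input_iter ixi.
  exact: (blin0 bf).
rewrite -(subnK al) -y_iter.
apply: past_free (leq_ltn_trans al lr) => // [j' b bq|k].
  rewrite past_iter; case: ltnP => [_|kb].
    by rewrite /= state0 input_iter ixi [g' _](blin0 bg) mxE.
  by apply: pxi; apply: leq_ltn_trans bq; rewrite leq_subr.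
by rewrite input_iter ixi.
Qed.

(** First reach the shifts of order below [r j], after discarding the unlisted
    past, which does not act on them; then correct the higher ones, which can be
    done without touching the lower ones. *)
Lemma input_onto K (tau : 'I_m -> nat -> R) : exists u, forall j l,
  (a j <= l < K)%N -> y j l (TPoint (fun=> 0) 0 u) = tau j l.
Proof.
have split_past xi' : state xi' = 0 -> xi' =
    tcomb 1 (TPoint (past xi') 0 (fun=> 0)) (TPoint (fun=> 0) 0 (input xi')).
  case: xi' => p s u /= ->; rewrite /tcomb /=.
  by congr TPoint; [apply/funext => b|..| apply/funext => k];
     rewrite scale1r ?addr0 ?add0r.
have [xi [pxi sxi yxi]] := listed_onto tau.
pose low : tpoint R n m := TPoint (fun=> 0) 0 (input xi).
have lowE j l : (a j <= l < r j)%N -> y j l low = tau j l.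
  move=> alr; rewrite -(yxi j l alr).
  rewrite (congr1 (y j l) (split_past xi sxi)) lshift_comb mul1r.
  by rewrite [X in _ = X + _]past_free_iter ?add0r.
have [u uE] := lshift_high_onto K (fun j l => tau j l - y j l low).
exists (fun k => input xi k + u k) => j l /andP[al lK].
have -> : TPoint (fun=> 0) 0 (fun k => input xi k + u k) =
    tcomb 1 low (TPoint (fun=> 0) 0 u).
  by rewrite /tcomb /=; congr TPoint; [apply/funext => b|..| apply/funext => k];
     rewrite scale1r ?addr0.
rewrite lshift_comb mul1r uE //; case: ltnP => lr; last by rewrite addrC subrK.
by rewrite addr0 lowE ?al.
Qed.

End LinearControl.

(** * Linearization of the system at the equilibrium *)

Section Linearization.
Context {R : realType} {n m : nat}.
Variable S : dsystem R n m.
Variables (q1 q2 : nat) (phi : window R n m q1 q2 -> 'rV[R]_m).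
Hypothesis phi_smooth : smooth_near phi (window_of q1 q2 (tpoint_eq S)).

Let xu0 := (sys_x0 S, sys_u0 S).
Definition df : 'rV[R]_n * 'rV[R]_m -> 'rV[R]_n := 'd (sys_f S) xu0.
Definition dg : 'rV[R]_n * 'rV[R]_m -> 'rV[R]_m := 'd (sys_g S) xu0.
Definition dphi : window R n m q1 q2 -> 'rV[R]_m :=
  'd phi (window_of q1 q2 (tpoint_eq S)).
Definition dyshift := lshift df dg dphi.

Let bb : bounded_basis ('rV[R]_n * 'rV[R]_m)%type.
Proof. by apply: bounded_basis_pair; exact: bounded_basis_mx. Qed.

Lemma bounded_basis_window lz lu : bounded_basis (window R n m lz lu).
Proof. by do 2?apply: bounded_basis_pair; exact: bounded_basis_mx. Qed.

Lemma f_C1 : C1_near (sys_f S) xu0.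
Proof. exact: smooth_near_strict bb (sys_f_smooth S). Qed.

Lemma g_C1 : C1_near (sys_g S) xu0.
Proof. exact: smooth_near_strict bb (sys_g_smooth S). Qed.

Lemma phi_C1 : C1_near phi (window_of q1 q2 (tpoint_eq S)).
Proof. exact: smooth_near_strict (bounded_basis_window _ _) phi_smooth. Qed.

Lemma df_blin : bounded_linear df.
Proof. exact: (C1_near_strict f_C1).1. Qed.

Lemma dg_blin : bounded_linear dg.
Proof. exact: (C1_near_strict g_C1).1. Qed.

Lemma dphi_blin : bounded_linear dphi.
Proof. exact: (C1_near_strict phi_C1).1. Qed.

Section Window.
Variables lz lu : nat.
Let w0 : window R n m lz lu := window_of lz lu (tpoint_eq S).
Let G k (w : window R n m lz lu) := iter k (step S) (of_window S w).
Let G' k (v : window R n m lz lu) := iter k (gstep df dg) (of_window0 v).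

Let G0 k : G k w0 = tpoint_eq S.
Proof. by rewrite /G of_window_eq iter_step_eq. Qed.

Lemma past_window_affine b w :
  strict_deriv (fun w : window R n m lz lu => past (of_window S w) b) w
    (fun v => past (of_window0 v) b).
Proof.
rewrite /=; case: insubP => [i _ _|_]; last exact: sd_cst.
apply: sd_lin; apply: blin_comp (blin_comp (blin_fst _ _) (blin_fst _ _)) _.
exact: blin_row.
Qed.

Lemma input_window_affine b w :
  strict_deriv (fun w : window R n m lz lu => input (of_window S w) b) w
    (fun v => input (of_window0 v) b).
Proof.
rewrite /=; case: insubP => [i _ _|_]; last exact: sd_cst.
by apply: sd_lin; apply: blin_comp (blin_snd _ _) _; exact: blin_row.
Qed.

Lemma state_window_affine w :
  strict_deriv (fun w : window R n m lz lu => state (of_window S w)) w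
    (fun v => state (of_window0 v)).
Proof.
by apply: sd_lin; exact: blin_comp (blin_fst _ _) (blin_snd _ _).
Qed.

(** Chain rule along the trajectory. As the equilibrium is a fixed point, the
    derivatives of [f] and [g] are taken at the same point in each step. *)
Lemma trajectory_strict k :
  [/\ forall b, strict_deriv (fun w => past (G k w) b) w0 (fun v => past (G' k v) b),
      strict_deriv (fun w => state (G k w)) w0 (fun v => state (G' k v))
    & forall i, strict_deriv (fun w => input (G k w) i) w0 (fun v => input (G' k v) i)].
Proof.
elim: k => [|k [IHp IHs IHi]].
  split=> [b||i]; [exact: past_window_affine|exact: state_window_affine|].
  exact: input_window_affine.
have sxu := sd_pair IHs (IHi 0%N).
have xuE : (state (G k w0), input (G k w0) 0%N) = xu0 by rewrite G0.
split=> [[|b]||i].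
- apply: (sd_comp sxu (k := sys_g S) (E := dg)).
  by rewrite xuE; exact: C1_near_strict g_C1.
- exact: IHp.
- apply: (sd_comp sxu (k := sys_f S) (E := df)).
  by rewrite xuE; exact: C1_near_strict f_C1.
- exact: IHi.
Qed.

Lemma trajectory_C1 k :
  [/\ forall b, C1_near (fun w => past (G k w) b) w0,
      C1_near (fun w => state (G k w)) w0
    & forall i, C1_near (fun w => input (G k w) i) w0].
Proof.
elim: k => [|k [IHp IHs IHi]].
  split=> [b||i]; apply: C1_near_all => w.
  - by eexists; exact: past_window_affine.
  - by eexists; exact: state_window_affine.
  - by eexists; exact: input_window_affine.
have sxu := C1_near_pair IHs (IHi 0%N).
have xuE : (state (G k w0), input (G k w0) 0%N) = xu0 by rewrite G0.
split=> [[|b]||i].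
- apply: (C1_near_comp sxu (k := sys_g S)).
  by rewrite xuE; exact: g_C1.
- exact: IHp.
- apply: (C1_near_comp sxu (k := sys_f S)).
  by rewrite xuE; exact: f_C1.
- exact: IHi.
Qed.

Lemma yshift_strict j k :
  strict_deriv (fun w => yshift S phi j k (of_window S w) : R^o) w0
    (fun v => dyshift j k (of_window0 v)).
Proof.
have [Hp Hs Hi] := trajectory_strict k.
under eq_fun do rewrite yshiftE.
apply: (sd_comp (h := fun w => phi (window_of q1 q2 (G k w)))
  (D := fun v => dphi (window_of q1 q2 (G' k v)))
  (k := fun M : 'rV[R]_m => M 0 j : R^o) (E := fun M : 'rV[R]_m => M 0 j)); last first.
  exact/sd_lin/blin_entry.
apply: (sd_comp (D := fun v => window_of q1 q2 (G' k v)) (k := phi) (E := dphi)); last first.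
  by rewrite G0; exact: C1_near_strict phi_C1.
apply: sd_pair; first apply: sd_pair => //.
  by apply: (sd_row (h := fun w (b : 'I_q1) => past (G k w) b)
     (D := fun v (b : 'I_q1) => past (G' k v) b)).
by apply: (sd_row (h := fun w (b : 'I_q2.+1) => input (G k w) b)
     (D := fun v (b : 'I_q2.+1) => input (G' k v) b)).
Qed.

Lemma yshift_C1 j k : C1_near (fun w => yshift S phi j k (of_window S w) : R^o) w0.
Proof.
have [Hp Hs Hi] := trajectory_C1 k.
under eq_fun do rewrite yshiftE.
apply: (C1_near_comp (h := fun w => phi (window_of q1 q2 (G k w)))
  (k := fun M : 'rV[R]_m => M 0 j : R^o)); last first.
  by apply: C1_near_all => q; eexists; exact/sd_lin/blin_entry.
apply: (C1_near_comp (h := fun w => window_of q1 q2 (G k w)) (k := phi)); last first.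
  by rewrite G0; exact: phi_C1.
apply: C1_near_pair; first apply: C1_near_pair => //.
  by apply: (C1_near_row (h := fun w (b : 'I_q1) => past (G k w) b)).
by apply: (C1_near_row (h := fun w (b : 'I_q2.+1) => input (G k w) b)).
Qed.

Variables r a : 'I_m -> nat.

Definition dlisted (i : listed_index n q1 r a) : tpoint R n m -> R :=
  match i with
  | inl (inl t) => fun p => past p (tagged t) 0 (tag t)
  | inl (inr k) => fun p => state p 0 k
  | inr t => dyshift (tag t) (a (tag t) + tagged t)
  end.

Lemma listed_strict i :
  strict_deriv (fun w => listed S phi i (of_window S w) : R^o) w0
    (fun v => dlisted i (of_window0 v)).
Proof.
case: i => [[t|k]|t]; last exact: yshift_strict.
- exact: sd_entry (past_window_affine (tagged t) w0).
- exact: sd_entry (state_window_affine w0).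
Qed.

Lemma listed_C1 (i : listed_index n q1 r a) :
  C1_near (fun w => listed S phi i (of_window S w) : R^o) w0.
Proof.
case: i => [[t|k]|t]; last exact: yshift_C1.
- apply: C1_near_all => q; exists (fun v => past (of_window0 v) (tagged t) 0 (tag t)).
  exact: sd_entry (past_window_affine (tagged t) q).
- apply: C1_near_all => q; exists (fun v => state (of_window0 v) 0 k).
  exact: sd_entry (state_window_affine q).
Qed.

End Window.

Lemma jet_eq_window lz lu d :
  jet S phi d (of_window S (window_of lz lu (tpoint_eq S))) = jet S phi d (tpoint_eq S).
Proof. by rewrite of_window_eq. Qed.

Lemma jet_strict lz lu d :
  strict_deriv (fun w => jet S phi d (of_window S w)) (window_of lz lu (tpoint_eq S))
    (fun v => ljet df dg dphi d (of_window0 v)).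
Proof.
apply: sd_matrix => i j.
under eq_fun do rewrite mxE; under [X in strict_deriv _ _ X]eq_fun do rewrite mxE.
exact: yshift_strict.
Qed.

(** Differentiate the identities for [F_x] and [F_u]. A window of length
    exceeding all the shifts in the jets determines them, so that the linear
    identities hold for arbitrary, also unbounded, tangent trajectories. *)
Lemma flat_linearized r : flat_repr S phi r ->
  exists Fx Fu, [/\ bounded_linear Fx, bounded_linear Fu,
    forall xi, Fx (ljet df dg dphi r xi) = state xi
  & forall xi, Fu (ljet df dg dphi (fun j => (r j).+1) xi) = input xi 0%N].
Proof.
move=> [Fx [Fu [sFx sFu [e e0 FE]]]].
have bbJ k : bounded_basis 'rV[R]_k by exact: bounded_basis_mx.
have cFx := C1_near_strict (smooth_near_strict (bbJ _) sFx).
have cFu := C1_near_strict (smooth_near_strict (bbJ _) sFu).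
set DFx := 'd Fx _ in cFx; set DFu := 'd Fu _ in cFu.
exists DFx, DFu; split; [exact: cFx.1|exact: cFu.1| |].
all: pose lu := (q2 + \max_j (r j).+1)%N.
all: pose w0 : window R n m q1 lu := window_of q1 lu (tpoint_eq S).
all: have nearw := near_eq_window S q1 lu e0.
all: have jetE (d : 'I_m -> nat) (xi : tpoint R n m) : (forall j, d j <= (r j).+1)%N ->
    ljet df dg dphi d (of_window0 (window_of q1 lu xi)) = ljet df dg dphi d xi.
1,3: move=> dr; apply/rowP => i; rewrite !mxE; case: (enum_val i) => j [l ld] /=;
  apply: lshift_agree; apply: agree_sub (of_window0K q1 lu xi) => //;
  rewrite ltnS leq_add2l (leq_trans (ltnW ld)) // (leq_trans (dr j)) //;
  exact: (@leq_bigmax _ (fun j => (r j).+1)).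
- move=> xi; rewrite -jetE //.
  have H1 : strict_deriv (fun w : window R n m q1 lu => Fx (jet S phi r (of_window S w)))
     w0 (fun v => DFx (ljet df dg dphi r (of_window0 v))).
    apply: (sd_comp (jet_strict q1 lu r)).
    by rewrite jet_eq_window.
  have H2 : \forall w \near w0, Fx (jet S phi r (of_window S w)) = state (of_window S w).
    by near=> w; case: (FE (of_window S w)) => //; near: w.
  have := sd_unique (state_window_affine w0) (sd_near_eq H2 H1).
  by move=> /(congr1 (fun F => F (window_of q1 lu xi))) <-.
- move=> xi; rewrite -jetE //.
  have H1 : strict_deriv (fun w : window R n m q1 lu =>
       Fu (jet S phi (fun j => (r j).+1) (of_window S w)))
     w0 (fun v => DFu (ljet df dg dphi (fun j => (r j).+1) (of_window0 v))).
    apply: (sd_comp (jet_strict q1 lu (fun j => (r j).+1))).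
    by rewrite jet_eq_window.
  have H2 : \forall w \near w0, Fu (jet S phi (fun j => (r j).+1) (of_window S w)) =
      input (of_window S w) 0%N.
    by near=> w; case: (FE (of_window S w)) => //; near: w.
  have := sd_unique (input_window_affine 0 w0) (sd_near_eq H2 H1).
  have [_ _ /(_ 0%N isT) <-] := of_window0K q1 lu xi.
  by move=> /(congr1 (fun F => F (window_of q1 lu xi))) <-.
Unshelve. all: by end_near. Qed.

End Linearization.

(** * Sufficiency *)

Section FreeFunctionals.
Context {K : fieldType} {V : vectType K} {I : eqType}.
Implicit Types (L : I -> 'Hom(V, K^o)) (s : seq I).

Lemma free_functionals L s : free [seq L i | i <- s] <->
  (forall c : 'rV[K]_(size s),
     (forall v, \sum_k c 0 k * L (tnth (in_tuple s) k) v = 0) -> c = 0).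
Proof.
have sumE (c : 'I_(size s) -> K) v :
    (\sum_k c k *: (map_tuple L (in_tuple s))`_k) v =
    \sum_k c k * L (tnth (in_tuple s) k) v.
  rewrite sum_lfunE; apply: eq_bigr => k _.
  by rewrite scale_lfunE -tnth_nth tnth_map.
split=> [/(@freeP _ _ _ (map_tuple L (in_tuple s))) fr c c0|H].
  apply/rowP => k; rewrite mxE; apply: (fr (fun k => c 0 k)).
  by apply/lfunP => v; rewrite sumE c0 lfunE.
apply/(@freeP _ _ _ (map_tuple L (in_tuple s))) => c /lfunP c0 k.
have /rowP/(_ k) : \row_k c k = 0; last by rewrite !mxE.
apply: H => v; have := c0 v; rewrite sumE lfunE /= => E.
by rewrite -[RHS]E; apply: eq_bigr => k' _; rewrite mxE.
Qed.

Lemma free_onto L s (tau : I -> K) : free [seq L i | i <- s] ->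
  exists v, forall i, i \in s -> L i v = tau i.
Proof.
move=> /free_functionals fr.
pose D v : 'rV[K]_(size s) := \row_k L (tnth (in_tuple s) k) v.
have lD : linear D.
  by move=> c u v; apply/rowP => k; rewrite !mxE linearP.
pose DL : {linear V -> 'rV[K]_(size s)} := HB.pack D (GRing.isLinear.Build K V _ _ D lD).
have [|v vE] := dual_onto (D := DL) _ (\row_k tau (tnth (in_tuple s) k)).
  move=> c c0; apply: fr => v; rewrite -[RHS](c0 v); apply: eq_bigr => k _.
  by rewrite mxE.
exists v => i /(tnthP (in_tuple s))[k ->].
have := congr1 (fun M : 'rV[K]_(size s) => M 0 k) vE.
by rewrite !mxE.
Qed.

End FreeFunctionals.

Section Sufficiency.
Context {R : realType} {n m : nat}.
Variable S : dsystem R n m.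
Variables (q1 q2 : nat) (phi : window R n m q1 q2 -> 'rV[R]_m).
Hypothesis phi_smooth : smooth_near phi (window_of q1 q2 (tpoint_eq S)).
Variables r a : 'I_m -> nat.

(** Moving along such a direction [xi] changes only the unlisted past, hence not
    the shift of the flat output. *)
Lemma past_suffices_linearized : listed_past_suffices S phi r a ->
  forall xi : tpoint R n m,
  (forall (j : 'I_m) b, (b < q1 - a j)%N -> past xi b 0 j = 0) ->
  state xi = 0 -> (forall k, input xi k = 0) ->
  forall j, (a j < r j)%N -> dyshift S phi j (a j) xi = 0.
Proof.
move=> [e e0 suff] xi pxi sxi ixi j ajr.
pose lu := (q2 + a j)%N; pose v := window_of q1 lu xi.
pose w0 : window R n m q1 lu := window_of q1 lu (tpoint_eq S).
have <- : dyshift S phi j (a j) (of_window0 v) = dyshift S phi j (a j) xi.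
  by apply: lshift_agree; exact: of_window0K.
apply/eqP; rewrite -normr_le0 -[leRHS](mul0r `|v|).
apply: (sd_line_bound (yshift_strict phi_smooth q1 lu j (a j))).
have near0 := near_eq_window S q1 lu e0.
near=> w => -[t wE].
rewrite mul0r normr_le0 subr_eq0; apply/eqP; apply: suff ajr => //.
- by near: w.
- exact: nbhs_singleton near0.
- move=> j' b bq; rewrite wE /=.
  have bq1 : (b < q1)%N by rewrite (leq_trans bq) // leq_subr.
  by rewrite insubT /= !mxE pxi // mulr0 addr0.
- by rewrite wE /= sxi scaler0 addr0.
- rewrite wE; apply/funext => k /=; case: insubP => // i _ _.
  by apply/rowP => j'; rewrite !mxE ixi mxE mulr0 addr0.
Unshelve. all: by end_near. Qed.

Lemma dlistedE lz lu (i : listed_index n q1 r a) :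
  'd (fun w => listed S phi i (of_window S w) : R^o)
    (window_of lz lu (tpoint_eq S)) = (fun v => dlisted S phi i (of_window0 v))
  :> (window R n m lz lu -> R^o).
Proof. exact: (sd_diff (listed_strict phi_smooth lz lu i)).2. Qed.

Lemma free_listed_onto lz lu :
  free (listed_diff S phi r a (window_of lz lu (tpoint_eq S))) ->
  forall tau : 'I_m -> nat -> R, exists xi,
  [/\ forall (j : 'I_m) b, (b < q1 - a j)%N -> past xi b 0 j = 0, state xi = 0
    & forall j l, (a j <= l < r j)%N -> dyshift S phi j l xi = tau j l].
Proof.
move=> fr tau.
have [v vE] := free_onto (I := listed_index n q1 r a)
  (fun i => if i is inr t then tau (tag t) (a (tag t) + tagged t)%N else 0) fr.
have {}vE (i : listed_index n q1 r a) : dlisted S phi i (of_window0 v) =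
    if i is inr t then tau (tag t) (a (tag t) + tagged t)%N else 0.
  by have := vE i; rewrite mem_enum => /(_ isT) <-; rewrite lfunE /= dlistedE.
exists (of_window0 v); split=> [j b bq||j l /andP[al lr]].
- exact: (vE (inl (inl (@Tagged _ j (fun j => 'I_(q1 - a j)) (Ordinal bq))))).
- by apply/rowP => k; rewrite mxE; exact: (vE (inl (inr k))).
have lr' : (l - a j < r j - a j)%N by rewrite ltn_sub2r // (leq_ltn_trans al).
have := vE (inr (@Tagged _ j (fun j => 'I_(r j - a j)) (Ordinal lr'))).
by rewrite /= subnKC.
Qed.

(** By [input_onto] the derivative of the shifts of order [a j] to [a j + L] with
    respect to the inputs alone is onto. Its right inverse has values in the
    input directions, so straightening leaves past and state of a window
    unchanged and these can be given in advance. *)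
Lemma permits_of_free lz lu : flat_repr S phi r ->
  listed_past_suffices S phi r a ->
  free (listed_diff S phi r a (window_of lz lu (tpoint_eq S))) ->
  permits_arbitrary_trajectories S phi a.
Proof.
move=> flat past_ok fr L e e0.
have [Fx [Fu [bFx bFu FxE FuE]]] := flat_linearized phi_smooth flat.
have onto := input_onto (df_blin S) (dg_blin S) (dphi_blin phi_smooth) bFx bFu
  FxE FuE (past_suffices_linearized past_ok) (free_listed_onto fr).
pose LU := (q2 + \max_j a j + L)%N.
pose w0 : window R n m q1 LU := window_of q1 LU (tpoint_eq S).
pose H (w : window R n m q1 LU) : 'rV[R]_#|{: 'I_m * 'I_L.+1}| := \row_i
  (let t : 'I_m * 'I_L.+1 := enum_val i in yshift S phi t.1 (a t.1 + t.2) (of_window S w)).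
pose D (v : window R n m q1 LU) : 'rV[R]_#|{: 'I_m * 'I_L.+1}| := \row_i
  (let t : 'I_m * 'I_L.+1 := enum_val i in dyshift S phi t.1 (a t.1 + t.2) (of_window0 v)).
have sH : strict_deriv H w0 D.
  apply: sd_matrix => i0 i.
  under eq_fun do rewrite mxE; under [X in strict_deriv _ _ X]eq_fun do rewrite mxE.
  exact: yshift_strict.
pose inj (U : 'M[R]_(LU.+1, m)) : window R n m q1 LU := (0, 0, U).
have binj : bounded_linear inj.
  split=> [c u v|]; first by congr (_, _, _); rewrite /= scaler0 addr0.
  exists 1 => // U; rewrite mul1r !pair_normE /= !normr0 maxxx.
  by rewrite ge_max normr_ge0 lexx.
have [B bB BK] : exists2 B, bounded_linear B & cancel B (fun U => D (inj U)).
  apply: right_inverse => [|s]; first exact: blin_comp binj sH.1.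
  have [u uE] := onto (\max_j a j + L).+1 (fun j l =>
    if insub (l - a j)%N is Some k then s 0 (enum_rank ((j, k) : 'I_m * 'I_L.+1)) else 0).
  exists (\matrix_(k < LU.+1) u k); apply/rowP => i; rewrite !mxE.
  case: (enum_val i) (enum_valK i) => j k /= ik.
  have kL := ltn_ord k.
  have aj : (a j <= \max_j a j)%N by exact: leq_bigmax.
  transitivity (dyshift S phi j (a j + k) (TPoint (fun=> 0) 0 u)).
    apply: lshift_agree; split=> //= [b bq|l lq].
      by rewrite insubT /=; apply/rowP => j'; rewrite !mxE.
    have lL : (l < LU.+1)%N by rewrite /LU; lia.
    by rewrite insubT /=; apply/rowP => j'; rewrite !mxE.
  rewrite /dyshift uE; last by lia.
  by rewrite addKn insubT /= -[in RHS]ik; congr (s 0 (enum_rank (_, _))); exact: val_inj.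
pose Bi s := inj (B s).
have bBi : bounded_linear Bi := blin_comp bB binj.
have BiK : cancel Bi D by exact: BK.
have [d1 d10 solve] := straighten_onto sH bBi e0.
have [C C0 bC] := bBi.2; have [CD CD0 bCD] := sH.1.2.
(* [M * d] bounds the distance from the straightened equilibrium to the point
   that has to be reached. *)
pose M := 1 + C * (1 + CD).
have M0 : 0 < M by rewrite addr_gt0 // mulr_gt0 // addr_gt0.
exists (Num.min (d1 / M / 2) 1) => [|z x v zd xd vd].
  by rewrite lt_min ltr01 !divr_gt0.
set d := Num.min _ _ in zd xd vd.
have d0 : 0 < d by rewrite lt_min ltr01 !divr_gt0.
pose wp : window R n m q1 LU := (\matrix_(b < q1) z b, x, \matrix_(k < LU.+1) sys_u0 S).
pose s : 'rV[R]_#|{: 'I_m * 'I_L.+1}| := \row_i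
  (let t : 'I_m * 'I_L.+1 := enum_val i in v t.2 0 t.1).
have wpd : `|wp - w0| <= d.
  rewrite !pair_normE /= !ge_max (ltW xd) andbT; apply/andP; split.
    apply/mx_norm_leP => [|b j]; first exact: ltW.
    have := zd b; rewrite !mxE => zb.
    by have := le_trans (mx_entry_le _ 0 j) (ltW zb); rewrite !mxE.
  apply/mx_norm_leP => [|b j]; first exact: ltW.
  by rewrite !mxE subrr normr0 ltW.
have sd : `|s - H w0| <= d.
  apply/mx_norm_leP => [|i0 i]; first exact: ltW.
  pose t : 'I_m * 'I_L.+1 := enum_val i.
  have := le_trans (mx_entry_le _ 0 t.1) (ltW (vd t.2)).
  by rewrite !mxE of_window_eq /= yshiftE iter_step_eq.
(* [wp] carries the given past and state, and [D] takes the value [s] at the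
   target point. *)
have [|w we wom] := solve (wp + Bi (s - D wp)).
  have -> : wp + Bi (s - D wp) - straighten H D Bi w0 =
      (wp - w0) + Bi ((s - H w0) - D (wp - w0)).
    rewrite /straighten opprD addrACA -(blinB _ _ bBi) (blinB wp w0 sH.1).
    by congr (_ + Bi _); rewrite !opprB (AC (2*2) ((1*4)*(3*2))).
  apply: (@le_lt_trans _ _ (M * d)).
    rewrite mulrDl mul1r (le_trans (ler_normD _ _)) // lerD //.
    rewrite (le_trans (bC _)) // -mulrA ler_wpM2l ?(ltW C0) //.
    rewrite (le_trans (ler_normB _ _)) // mulrDl mul1r lerD //.
    by rewrite (le_trans (bCD _)) // ler_wpM2l // ltW.
  rewrite mulrC -ltr_pdivlMr //; apply: (@le_lt_trans _ _ (d1 / M / 2)).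
    by rewrite /d ge_min lexx.
  by rewrite ltr_pdivrMr // ltr_pMr ?divr_gt0 // ltr1n.
have Hw : H w = s.
  rewrite -(straightenE sH BiK) wom (blinD _ _ sH.1) BiK.
  by rewrite addrC subrK.
have w11 : w.1.1 = wp.1.1.
  by have := congr1 (fun q : window R n m q1 LU => q.1.1) wom; rewrite /= !addr0.
have w12 : w.1.2 = x.
  by have := congr1 (fun q : window R n m q1 LU => q.1.2) wom; rewrite /= !addr0.
exists (input (of_window S w)); split=> [k|k j kL].
  rewrite /=; case: insubP => [i _ _|_]; last by rewrite subrr normr0.
  apply: le_lt_trans we; apply: le_trans (snd_norm_le _).
  apply: mx_norm_leP => // i0 j.
  by have := mx_entry_le (w - w0).2 i j; rewrite !mxE ord1.
have kL' : (k < L.+1)%N by [].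
rewrite yshift_iter.
have -> : yshift S phi j (a j + k) (TPoint z x (input (of_window S w))) =
    yshift S phi j (a j + k) (of_window S w).
  apply: yshift_agree; split=> //= b bq.
  by rewrite insubT /= w11; apply/rowP => j'; rewrite !mxE.
have := congr1 (fun M : 'rV[R]_#|{: 'I_m * 'I_L.+1}| => 
  M 0 (enum_rank ((j, Ordinal kL') : 'I_m * 'I_L.+1))) Hw.
by rewrite /= !mxE enum_rankK.
Qed.

End Sufficiency.

(** * Necessity *)

Section Necessity.
Context {R : realType} {n m : nat}.
Variable S : dsystem R n m.
Variables (q1 q2 : nat) (phi : window R n m q1 q2 -> 'rV[R]_m).
Hypothesis phi_smooth : smooth_near phi (window_of q1 q2 (tpoint_eq S)).
Variables (r a : 'I_m -> nat) (lz lu : nat).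
Hypotheses (lz_large : (q1 <= lz)%N) (lu_large : forall j, (q2 + r j <= lu)%N).

Let w0 := window_of lz lu (tpoint_eq S).
Let I := listed_index n q1 r a.
Let h (i : I) (w : window R n m lz lu) : R^o := listed S phi i (of_window S w).
Let X (w : window R n m lz lu) (i : I) : 'Hom(window R n m lz lu, R^o) :=
  linfun ('d (h i) w).

Lemma listed_agree (i : I) p p' : agree lz lu.+1 p p' ->
  listed S phi i p = listed S phi i p'.
Proof.
case: i => [[[j b]|k]|[j l]] [Hp Hs Hi] /=.
- by rewrite Hp // (leq_trans (ltn_ord b)) // (leq_trans (leq_subr _ _)).
- by rewrite Hs.
- apply: yshift_agree; apply: (@agree_sub _ _ _ lz lu.+1) => //.
  by have := lu_large j; have := ltn_ord l; lia.
Qed.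

(** The listed zeta and x are prescribed through the initial data, the listed
    shifts of order [a j + k] through the reference at time [k]; the bound on
    the inputs keeps the window close to the equilibrium. *)
Lemma listed_values : permits_arbitrary_trajectories S phi a ->
  forall e, 0 < e -> exists2 d, 0 < d & forall t : I -> R,
    (forall i, `|t i - h i w0| < d) ->
    exists w, `|w - w0| < e /\ forall i, h i w = t i.
Proof.
move=> permits e e0.
have [d d0 Hd] := permits (\max_j r j) e e0.
exists (Num.min d e) => [|t td]; first by rewrite lt_min d0.
have {}td i : `|t i - listed S phi i (tpoint_eq S)| < Num.min d e.
  by have := td i; rewrite /h /w0 of_window_eq.
have dist0 (c : R) : `|c - c| < Num.min d e by rewrite subrr normr0 lt_min d0.
pose z (b : nat) : 'rV[R]_m := \row_j
  if insub b : option 'I_(q1 - a j) is Some b'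
  then t (inl (inl (@Tagged _ j (fun j => 'I_(q1 - a j)) b'))) else sys_z0 S 0 j.
pose x : 'rV[R]_n := \row_k t (inl (inr k)).
pose v (k : nat) : 'rV[R]_m := \row_j
  if insub k : option 'I_(r j - a j) is Some k'
  then t (inr (@Tagged _ j (fun j => 'I_(r j - a j)) k'))
  else phi (window_of q1 q2 (tpoint_eq S)) 0 j.
have mn0 : 0 < Num.min d e by rewrite lt_min d0.
have zd b : `|z b - sys_z0 S| < Num.min d e.
  apply: mx_norm_ltP => // i0 j; rewrite ord1 !mxE.
  case: insubP => [b' _ _|_] //; exact: td (inl (inl (Tagged _ b'))).
have xd : `|x - sys_x0 S| < Num.min d e.
  apply: mx_norm_ltP => // i0 k; rewrite ord1 !mxE.
  exact: td (inl (inr k)).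
have vd k : `|v k - phi (window_of q1 q2 (tpoint_eq S))| < Num.min d e.
  apply: mx_norm_ltP => // i0 j; rewrite ord1 !mxE.
  case: insubP => [k' _ _|_] //; have := td (inr (@Tagged _ j (fun j => 'I_(r j - a j)) k')).
  by rewrite /= yshiftE iter_step_eq.
have ltd y : y < Num.min d e -> y < d by rewrite lt_min => /andP[].
have lte y : y < Num.min d e -> y < e by rewrite lt_min => /andP[].
have [u [ue uv]] := Hd z x v (fun b => ltd _ (zd b)) (ltd _ xd) (fun k => ltd _ (vd k)).
exists (window_of lz lu (TPoint z x u)); split.
  rewrite !pair_normE /= !gt_max (lte _ xd) andbT; apply/andP; split.
    apply: mx_norm_ltP => // b j.
    by have := le_lt_trans (mx_entry_le _ 0 j) (lte _ (zd b)); rewrite !mxE.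
  apply: mx_norm_ltP => // b j.
  by have := le_lt_trans (mx_entry_le _ 0 j) (ue b); rewrite !mxE.
move=> i; rewrite /h (listed_agree i (of_windowK _ _ _ _)).
case: i => [[[j b]|k]|[j l]] /=.
- by rewrite mxE insubT //= => hb; congr (t (inl (inl (Tagged _ _)))); exact: val_inj.
- by rewrite mxE.
- rewrite -yshift_iter uv; last first.
    have lr := ltn_ord l; rewrite (leq_trans (ltnW lr)) // (leq_trans (leq_subr _ _)) //.
    exact: leq_bigmax.
  by rewrite mxE insubT //= => hl; congr (t (inr (Tagged _ _))); exact: val_inj.
Qed.

(** A maximal free subfamily [s] of the listed differentials stays free nearby,
    and by constant rank stays a basis of their span. If [i0] is not in [s], then
    [h i0] is a function of the [h i] with [i] in [s] near the equilibrium, whereas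
    [listed_values] varies it while keeping them fixed. *)
Lemma free_of_permits : listed_constant_rank S phi r a lz lu ->
  permits_arbitrary_trajectories S phi a ->
  free (listed_diff S phi r a w0).
Proof.
move=> crank permits.
have hC1 i : C1_near (h i) w0 := listed_C1 phi_smooth lz lu i.
have [s [_ frs spans]] := span_select (X w0) (enum I).
have sub_s w : (<<[seq X w i | i <- s]>> <= <<listed_diff S phi r a w>>)%VS.
  by apply: sub_span => _ /mapP[i _ ->]; rewrite map_f ?mem_enum.
have dim_s : \dim <<listed_diff S phi r a w0>> = size s.
  have /eqP := frs; rewrite size_map => <-; congr (\dim _).
  apply/eqP; rewrite eqEsubv sub_s andbT; apply/span_subvP => _ /mapP[i iI ->].
  exact: spans.
have [/forallP all_s|] := boolP [forall i : I, i \in s].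
  have card_s : (size (enum I) <= size s)%N.
    by apply: uniq_leq_size; [exact: enum_uniq | move=> i _; exact: all_s].
  by rewrite /free eqn_leq dim_span dim_s size_map.
move=> /forallPn[i0 i0s]; exfalso.
pose tn k := tnth (in_tuple s) k.
pose H (w : window R n m lz lu) : 'rV[R]_(size s) := \row_k h (tn k) w.
pose D w (v : window R n m lz lu) : 'rV[R]_(size s) := \row_k ('d (h (tn k)) w v).
have sH : \forall w \near w0, strict_deriv H w (D w).
  have : \forall w \near w0, forall k, exists E, strict_deriv (h (tn k)) w E.
    exact: (@filter_forall _ _ (fun k w => exists E, strict_deriv (h (tn k)) w E)
      (nbhs w0) _ (fun k => hC1 (tn k))).
  apply: filterS => w Hw; apply: sd_matrix => i k.
  under eq_fun do rewrite mxE; under [X in strict_deriv _ _ X]eq_fun do rewrite mxE.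
  by have [E sE] := Hw k; have [_ ->] := sd_diff sE.
have sH0 : strict_deriv H w0 (D w0) := nbhs_singleton sH.
have annihilator w : free [seq X w i | i <- s] <->
    forall c : 'rV[R]_(size s), (forall v, \sum_k c 0 k * D w v 0 k = 0) -> c = 0.
  apply: iff_trans (free_functionals (X w) s) _.
  by split=> fr c c0; apply: fr => v; rewrite -[RHS](c0 v); apply: eq_bigr => k _;
    rewrite mxE lfunE.
have [B bB BK] : exists2 B, bounded_linear B & cancel B (D w0).
  apply: (right_inverse sH0.1) => t.
  have [L DL _] := blin_linear sH0.1.
  rewrite DL; apply: dual_onto => c c0; apply: ((annihilator w0).1 frs) => v.
  by rewrite DL.
have span_near : \forall w \near w0, X w i0 \in <<[seq X w i | i <- s]>>%VS.
  near=> w.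
  have sHw : strict_deriv H w (D w) by near: w.
  have frw : free [seq X w i | i <- s].
    apply/annihilator; suff : forall E, strict_deriv H w E ->
      forall c : 'rV[R]_(size s), (forall v, \sum_k c 0 k * E v 0 k = 0) -> c = 0.
      by apply.
    by near: w; exact: independent_near sH0 bB BK.
  have dimw : \dim <<listed_diff S phi r a w>> = size s.
    by rewrite -dim_s; near: w; exact: crank.
  have /eqP -> : <<[seq X w i | i <- s]>>%VS == <<listed_diff S phi r a w>>%VS.
    rewrite eqEdim sub_s dimw.
    by have /eqP -> := frw; rewrite size_map /=.
  by apply: memv_span; rewrite map_f ?mem_enum.
have fibre : \forall w \near w0, H w = H w0 -> h i0 w = h i0 w0.
  apply: (fibre_constant sH0 bB BK); near=> w.
  have sHw : strict_deriv H w (D w) by near: w.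
  have [E sE] : exists E, strict_deriv (h i0) w E by near: w; exact: hC1.
  have : X w i0 \in <<map_tuple (X w) (in_tuple s)>>%VS by near: w; exact: span_near.
  move=> /coord_span XE.
  pose lam (t : 'rV[R]_(size s)) : R^o :=
    \sum_k coord (map_tuple (X w) (in_tuple s)) k (X w i0) * t 0 k.
  exists (D w), E, lam; split=> //.
    apply: linear_bounded_basis; first exact: bounded_basis_mx.
    move=> c u v; rewrite scaler_sumr -big_split; apply: eq_bigr => k _ /=.
    by rewrite !mxE mulrDr mulrCA.
  move=> v; have [_ dE] := sd_diff sE.
  have -> : E v = X w i0 v by rewrite lfunE /= dE.
  rewrite {1}XE sum_lfunE; apply: eq_bigr => k _.
  by rewrite scale_lfunE -tnth_nth tnth_map lfunE mxE.
have /nearP_norm[e e0 fib] := fibre.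
have [d d0 vals] := listed_values permits e0.
have [|w [we wt]] := vals (fun i => h i w0 + (if i == i0 then d / 2 else 0)).
  move=> i; rewrite addrC addKr; case: ifP => _; last by rewrite normr0.
  by rewrite ger0_norm ?ltW ?divr_gt0 // ltr_pdivrMr // ltr_pMr // ltr1n.
have /(fib _ we) : H w = H w0.
  apply/rowP => k; rewrite !mxE wt ifN ?addr0 //.
  by apply: contraNneq i0s => <-; exact: mem_tnth.
rewrite wt eqxx => /eqP; rewrite -subr_eq0 addrC addKr => /eqP d20.
by have := divr_gt0 d0 (ltr0Sn R 1); rewrite d20 ltxx.
Unshelve. all: by end_near. Qed.

End Necessity.

Lemma free_of_dim (K : fieldType) (V : vectType K) (X Y : seq V) :
  \dim <<X>> = \dim <<Y>> -> size X = size Y -> free Y -> free X.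
Proof. by rewrite /free => -> ->. Qed.

Theorem theorem4p2 (R : realType) (n m : nat) (S : dsystem R n m)
    (q1 q2 : nat) (phi : window R n m q1 q2 -> 'rV[R]_m)
    (r a : 'I_m -> nat) (lz lu : nat)
    (phi_flat : flat_output S phi r)
    (lz_large : (q1 <= lz)%N)
    (lu_large : forall j, (q2 + r j <= lu)%N)
    (past_suffices : listed_past_suffices S phi r a)
    (constant_rank : listed_constant_rank S phi r a lz lu) :
  permits_arbitrary_trajectories S phi a <->
  listed_diff_independent S phi r a lz lu.
Proof.
have [phi_smooth flat _] := phi_flat; split=> [permits|indep].
  have fr := free_of_permits phi_smooth lz_large lu_large constant_rank permits.
  near=> w.
  have dimw : \dim <<listed_diff S phi r a w>> =
     \dim <<listed_diff S phi r a (window_of lz lu (tpoint_eq S))>>.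
    by near: w; exact: constant_rank.
  have sz : size (listed_diff S phi r a w) =
     size (listed_diff S phi r a (window_of lz lu (tpoint_eq S))).
    exact: etrans (size_map _ _) (esym (size_map _ _)).
  exact: free_of_dim dimw sz fr.
exact: (permits_of_free phi_smooth flat past_suffices (nbhs_singleton indep)).
Unshelve. all: by end_near. Qed.
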